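(* Let $l\ge 1$ be an integer. Let $\underline{\Pi}_l(z)=(\varpi_{l,0}(z),\dots,\varpi_{l,l-1}(z))^T$ be the Frobenius basis at $z=0$ of the solution space of the $l$-loop equal-mass banana Picard--Fuchs operator $\mathcal{L}_l$, and let $\mathbf{\Sigma}_l$ be the $l\times l$ anti-diagonal matrix with alternating signs (all as in the context). Then for $0<z<1/(l+1)^2$ $$\underline{\Pi}_l(z)^T\,\mathbf{\Sigma}_l\,\partial_z^k\underline{\Pi}_l(z)=\begin{cases}0, & 0\le k<l-1,\\ C_l(z), & k=l-1,\end{cases}$$ where $$C_l(z)=\frac{1}{z^{\,l-3}\prod_{m\in\Delta^{(l)}}(1-mz)} .$$
   Context: Notation. $\Delta^{(l)}=\{(l+1-2j)^2:\ 0\le j\le \lceil (l-1)/2\rceil\}$. Holomorphic solution: $$\varpi_{l,0}(z)=\sum_{k_1,\dots,k_{l+1}\ge 0}\left(\frac{(k_1+\dots+k_{l+1})!}{k_1!\cdots k_{l+1}!}\right)^2 z^{k_1+\dots+k_{l+1}+1}.$$ The banana Picard--Fuchs operator $\mathcal{L}_l=\sum_{k=0}^l B_{l,k}(z)\partial_z^k$ is the linear differential operator of order $l$ with polynomial coefficients and leading coefficient $B_{l,l}(z)=(-z)^l\prod_{m\in\Delta^{(l)}}(1-mz)$ which annihilates $\varpi_{l,0}$. It is Fuchsian, its nonzero finite singular points are $z=1/m$, $m\in\Delta^{(l)}$, and at $z=0$ all its $l$ local exponents are equal to $1$ (maximally unipotent monodromy). For example, with $\theta=z\partial_z$: $\mathcal{L}_1=1-2z-(1-4z)\theta$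 and $\mathcal{L}_2=1-3z-(2-10z)\theta+(1-z)(1-9z)\theta^2$. For $l$-loop equal-mass banana Feynman integrals in two dimensions, the solutions of $\mathcal{L}_l f=0$ are the maximal cuts, i.e. periods of a family of Calabi--Yau $(l-1)$-folds. Frobenius basis: $\varpi_{l,0},\dots,\varpi_{l,l-1}$ is the basis of solutions of $\mathcal{L}_l f=0$ of the form $$\varpi_{l,k}(z)=\sum_{j=0}^{k}\frac{1}{(k-j)!}\log^{k-j}(z)\,\Sigma_{l,j}(z),$$ with $\Sigma_{l,j}$ holomorphic near $z=0$ and normalized by $\Sigma_{l,0}(z)=z+O(z^2)$, $\Sigma_{l,j}(z)=O(z^2)$ for $j\ge1$. For $0<z<1/(l+1)^2$ the real branch of the logarithm is used. $\mathbf{\Sigma}_l$ is the $l\times l$ matrix with entries $(\mathbf{\Sigma}_l)_{i,\,l+1-i}=(-1)^{i+1}$ for $1\le i\le l$ and all other entries $0$. *)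

(* Defs.v *)
From HB Require Import structures.
From mathcomp Require Import all_boot all_order all_algebra.
From mathcomp Require Import all_classical all_reals all_analysis.
Set Implicit Arguments.
Unset Strict Implicit.
Unset Printing Implicit Defensive.
Import Order.TTheory GRing.Theory Num.Theory.
Import numFieldNormedType.Exports.
Local Open Scope classical_set_scope.
Local Open Scope ring_scope.

(** The set [Delta^(l)], listed by [j].  For [l >= 1], [uphalf l.-1] is
    [ceil((l-1)/2)], the subtraction never truncates, and the listed squares
    are positive and pairwise distinct, so no element is repeated. *)
Definition Delta (l : nat) : seq nat :=
  [seq ((l.+1 - j.*2) ^ 2)%N | j <- iota 0 (uphalf l.-1).+1].

Definition radius (R : realType) (l : nat) : R := (l.+1%:R ^+ 2)^-1.

(** Coefficient of [z ^ n.+1] in the multiple series for the holomorphic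
    solution: the sum over all [(k_1, ..., k_(l+1))] with sum [n] (so that
    each [k_i <= n]).  Grouping by total degree is harmless, all terms being
    nonnegative for [z > 0]. *)
Definition banana_coef (R : realType) (l n : nat) : R :=
  \sum_(k : {ffun 'I_l.+1 -> 'I_n.+1} | (\sum_i k i)%N == n)
    (n`!%:R / \prod_i (k i)`!%:R) ^+ 2.

Definition banana_holo (R : realType) (l : nat) (z : R) : R :=
  limn (series (fun n => banana_coef R l n * z ^+ n.+1)).

(** A differential operator [sum_(k <= l) B_k d^k/dz^k] is given by its
    coefficients [B : nat -> {poly R}]; only [B 0, ..., B l] are relevant.
    [solves l B r f]: on [0 < z < r] the function [f] is [l] times
    differentiable and is annihilated by the operator. *)
Definition solves (R : realType) (l : nat) (B : nat -> {poly R}) (r : R)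
    (f : R -> R) : Prop :=
  forall z : R, 0 < z < r ->
    (forall k : nat, (k < l)%N -> derivable (derive1n k f) z 1) /\
    \sum_(k < l.+1) (B k).[z] * derive1n k f z = 0.

(** Fuchs' criterion: at a finite point [a], [B_k / B_l] has a pole of order at
    most [l - k]; at infinity, [deg B_k - k <= deg B_l - l].  Only real points
    are inspected: the operators considered below have a leading coefficient
    all of whose complex roots are real. *)
Definition fuchsian (R : realType) (l : nat) (B : nat -> {poly R}) : Prop :=
  (forall (a : R) (k : nat), (k <= l)%N ->
     ('X - a%:P) ^+ (mup a (B l)) %| B k * ('X - a%:P) ^+ (l - k)) /\
  (forall k : nat, (k <= l)%N -> B k != 0 ->
     (size (B k) + l <= size (B l) + k)%N).

(** Indicial polynomial at [z = 0] of an operator whose leading coefficient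
    vanishes to order exactly [l] there and which is Fuchsian at [0], so that
    [z ^ k] divides [B_k]. *)
Definition indicial0 (R : realType) (l : nat) (B : nat -> {poly R}) : {poly R} :=
  \sum_(k < l.+1) (B k)`_k *: \prod_(i < k) ('X - (i%:R)%:P).

(** The banana Picard-Fuchs operator of order [l]. *)
Record banana_PF (R : realType) (l : nat) (B : nat -> {poly R}) : Prop :=
  BananaPF {
    banana_lead :
      B l = (- 'X) ^+ l * \prod_(m <- Delta l) (1 - (m%:R)%:P * 'X);
    banana_annihilates : solves l B (radius R l) (banana_holo l);
    banana_fuchsian : fuchsian l B;
    banana_exponents : indicial0 l B = (B l)`_l *: ('X - 1) ^+ l
  }.

(** [varpi 0, ..., varpi l.-1] is the Frobenius basis at [0]: solutions on
    [0 < z < 1/(l+1)^2] which, near [0], are given by the logarithmic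
    expansion, [c j] being the Taylor coefficients of [Sig j] at [0].
    Linear independence follows from the leading terms
    [z * ln z ^ k / k!], and these data determine the [varpi k], [k < l], on
    the whole interval; in particular [varpi 0] is [banana_holo l] there. *)
Definition frobenius_basis (R : realType) (l : nat) (B : nat -> {poly R})
    (varpi : nat -> R -> R) : Prop :=
  (forall k : nat, (k < l)%N -> solves l B (radius R l) (varpi k)) /\
  exists (Sig : nat -> R -> R) (c : nat -> nat -> R) (e : R),
    [/\ 0 < e,
        forall (j : nat) (z : R), (j < l)%N -> `|z| < e ->
          series (fun n => c j n * z ^+ n) @ \oo --> Sig j z,
        forall j : nat, (j < l)%N -> c j 0%N = 0 /\ c j 1%N = (j == 0%N)%:R &
        forall (k : nat) (z : R), (k < l)%N -> 0 < z < radius R l -> z < e ->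
          varpi k z =
            \sum_(j < k.+1) ((k - j)`!%:R)^-1 * ln z ^+ (k - j) * Sig j z].

(** The vector of the [k]-th derivatives of [varpi 0, ..., varpi l.-1]. *)
Definition dPi (R : realType) (l : nat) (varpi : nat -> R -> R) (k : nat)
    (z : R) : 'cV[R]_l :=
  \col_(i < l) derive1n k (varpi i) z.

(** With indices starting at [0], the sign in row [i] is [(-1) ^ i]. *)
Definition SigmaM (R : realType) (l : nat) : 'M[R]_l :=
  \matrix_(i < l, j < l) (if (i + j).+1 == l then (-1) ^+ i else 0).

(** The exponent [l - 3] is an integer, possibly negative. *)
Definition Cl (R : realType) (l : nat) (z : R) : R :=
  (z ^ (l%:Z - 3%:Z) * \prod_(m <- Delta l) (1 - m%:R * z))^-1.

(* Main.v *)
Require Import Defs.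
From HB Require Import structures.
From mathcomp Require Import all_boot all_order all_algebra.
From mathcomp Require Import all_classical all_reals all_analysis.
From mathcomp Require Import zify ring lra.
Import Order.TTheory GRing.Theory Num.Theory.
Import numFieldNormedType.Exports.
Local Open Scope classical_set_scope.
Local Open Scope ring_scope.

Set Implicit Arguments.
Unset Strict Implicit.
Unset Printing Implicit Defensive.

(** The coefficient of [z^(n+1)] in the holomorphic solution is [n!^2 a_n],
    where [I_0(2 sqrt u)^(l+1) = sum_n a_n u^n].  The symmetric power of the
    Bessel operator therefore yields an explicit operator [sum_j z^j q_j(theta)],
    [theta = z d/dz], which annihilates the holomorphic solution divided by [z]
    and is formally (anti-)self-adjoint: [q_j(-x-j) = (-1)^l q_j(x)].

    The given operator coincides with it.  Their difference would give a
    relation between [I_0^(l+1)] and its derivatives of too small a degree in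
    [u], and no such relation exists because [I_0] and its derivative are
    algebraically independent over the polynomials in [sqrt u].

    By self-adjointness the bilinear concomitant of two solutions is constant;
    its values on the Frobenius basis are read off the logarithmic asymptotics
    at [0+] and form the matrix [Sigma_l].  Writing this as
    [Phi^T M Phi = Sigma_l], with [Phi] the Wronskian matrix and [M] vanishing
    below its antidiagonal, the relations are the first row of [M^-1]. *)

(** * Formal power series *)

(** The hypotheses describe the operator through its leading coefficient, its exponents, Fuchs'
    criterion and one solution, so self-adjointness is not visible in them; the crux is that these
    data determine the operator. Fuchs' criterion at [0] and at infinity turns it into
    [sum_(j <= d) z^j Q_j(theta)] acting on [f / z], with [d = size (Delta l)], and the exponents
    fix [Q_0]. The difference from the explicit operator is thus [z] times an operator with [d]
    coefficients, and [2 d <= l + 2] is just what the independence argument can bear: with [d + 1]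
    coefficients the explicit operator is itself a relation. That argument puts no bound on the
    degrees of these coefficients in [theta]. The variable [s] with [u = s^2] is chosen because
    [theta I_0(2 s) = s I_1(2 s)]: the ring generated by [I_0(2 s)] and [I_1(2 s)] over the
    polynomials in [s] is stable under [theta]. *)

Record fps (R : Type) := Fps { fps_coef : nat -> R }.

HB.instance Definition _ (R : Type) := gen_eqMixin (fps R).
HB.instance Definition _ (R : Type) := gen_choiceMixin (fps R).

Lemma fpsP (R : Type) (f g : fps R) : fps_coef f =1 fps_coef g -> f = g.
Proof. by case: f g => f [g] /= /funext ->. Qed.

Section FpsRing.
Variable R : comNzRingType.
Implicit Types (f g h : fps R) (p q : {poly R}).

Definition fps_zero : fps R := Fps (fun=> 0).
Definition fps_one : fps R := Fps (fun n => (n == 0)%:R).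
Definition fps_add f g : fps R := Fps (fun n => fps_coef f n + fps_coef g n).
Definition fps_opp f : fps R := Fps (fun n => - fps_coef f n).
Definition fps_mul f g : fps R :=
  Fps (fun n => \sum_(i < n.+1) fps_coef f i * fps_coef g (n - i)).

Definition fps_trunc N f : {poly R} := \poly_(i < N.+1) fps_coef f i.

(** A coefficient of a product depends only on truncations of the factors, so the ring laws of
    series are inherited from polynomials. *)
Lemma coef_fps_mul_trunc N f g n : (n <= N)%N ->
  fps_coef (fps_mul f g) n = (fps_trunc N f * fps_trunc N g)`_n.
Proof.
move=> nN; rewrite coefM /=; apply: eq_bigr => i _.
by rewrite !coef_poly !ltnS (leq_trans _ nN) ?leq_ord// (leq_trans (leq_subr _ _) nN).
Qed.

Lemma coefM_low (p q r : {poly R}) N n : (n <= N)%N ->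
  (forall i, (i <= N)%N -> p`_i = q`_i) -> (p * r)`_n = (q * r)`_n.
Proof.
move=> nN pq; rewrite !coefM; apply: eq_bigr => i _.
by rewrite pq// (leq_trans _ nN)// leq_ord.
Qed.

Lemma coef_fps_trunc_mul N f g n : (n <= N)%N ->
  (fps_trunc N (fps_mul f g))`_n = (fps_trunc N f * fps_trunc N g)`_n.
Proof.
by move=> nN; rewrite coef_poly ltnS nN (coef_fps_mul_trunc _ _ nN).
Qed.

Fact fps_addA : associative fps_add.
Proof. by move=> f g h; apply: fpsP => n /=; rewrite addrA. Qed.
Fact fps_addC : commutative fps_add.
Proof. by move=> f g; apply: fpsP => n /=; rewrite addrC. Qed.
Fact fps_add0 : left_id fps_zero fps_add.
Proof. by move=> f; apply: fpsP => n /=; rewrite add0r. Qed.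
Fact fps_addN : left_inverse fps_zero fps_opp fps_add.
Proof. by move=> f; apply: fpsP => n /=; rewrite addNr. Qed.

HB.instance Definition _ :=
  GRing.isZmodule.Build (fps R) fps_addA fps_addC fps_add0 fps_addN.

Fact fps_mulC : commutative fps_mul.
Proof.
move=> f g; apply: fpsP => n.
by rewrite !(coef_fps_mul_trunc _ _ (leqnn n)) mulrC.
Qed.

Fact fps_mulA : associative fps_mul.
Proof.
move=> f g h; apply: fpsP => n; rewrite !(coef_fps_mul_trunc _ _ (leqnn n)).
rewrite mulrC (coefM_low _ (leqnn n) (coef_fps_trunc_mul g h)).
rewrite (coefM_low _ (leqnn n) (coef_fps_trunc_mul f g)).
by rewrite mulrC mulrA.
Qed.

Fact fps_mul1 : left_id fps_one fps_mul.
Proof.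
move=> f; apply: fpsP => n /=; rewrite big_ord_recl subn0 mul1r big1 ?addr0//.
by move=> i _; rewrite mul0r.
Qed.

Fact fps_mulD : left_distributive fps_mul fps_add.
Proof.
move=> f g h; apply: fpsP => n /=; rewrite -big_split /=.
by apply: eq_bigr => i _; rewrite mulrDl.
Qed.

Fact fps_one_neq0 : fps_one != 0.
Proof.
by apply/eqP => /(congr1 (fun f => fps_coef f 0)) /eqP; rewrite /= oner_eq0.
Qed.

HB.instance Definition _ := GRing.Zmodule_isComNzRing.Build (fps R)
  fps_mulA fps_mulC fps_mul1 fps_mulD fps_one_neq0.

Lemma fps_coefD f g n : fps_coef (f + g) n = fps_coef f n + fps_coef g n.
Proof. by []. Qed.
Lemma fps_coefN f n : fps_coef (- f) n = - fps_coef f n.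
Proof. by []. Qed.
Lemma fps_coef0 n : fps_coef (0 : fps R) n = 0.
Proof. by []. Qed.
Lemma fps_coefM f g n :
  fps_coef (f * g) n = \sum_(i < n.+1) fps_coef f i * fps_coef g (n - i).
Proof. by []. Qed.

Lemma fps_coef_sum (I : Type) (r : seq I) (P : pred I) (F : I -> fps R) n :
  fps_coef (\sum_(i <- r | P i) F i) n = \sum_(i <- r | P i) fps_coef (F i) n.
Proof. exact: (big_morph (fun f => fps_coef f n) (fun _ _ => erefl) erefl). Qed.

Definition fps_of_poly (p : {poly R}) : fps R := Fps (fun n => p`_n).

Fact fps_of_poly_is_zmod_morphism : zmod_morphism fps_of_poly.
Proof. by move=> p q; apply: fpsP => n /=; rewrite coefB. Qed.

Fact fps_of_poly_is_monoid_morphism : monoid_morphism fps_of_poly.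
Proof.
split; first by apply: fpsP => n /=; rewrite coef1.
by move=> p q; apply: fpsP => n; rewrite fps_coefM /= coefM.
Qed.

HB.instance Definition _ :=
  GRing.isZmodMorphism.Build {poly R} (fps R) fps_of_poly
    fps_of_poly_is_zmod_morphism.
HB.instance Definition _ :=
  GRing.isMonoidMorphism.Build {poly R} (fps R) fps_of_poly
    fps_of_poly_is_monoid_morphism.

Lemma fps_of_poly_inj : injective fps_of_poly.
Proof. by move=> p q pq; apply/polyP => n; have := congr1 (fun f => fps_coef f n) pq. Qed.

Lemma fps_coefXnM k f n : fps_coef (fps_of_poly 'X^k * f) n =
  if (n < k)%N then 0 else fps_coef f (n - k).
Proof.
rewrite (coef_fps_mul_trunc _ _ (leqnn n)) (coefM_low (q := 'X^k) _ (leqnn n)).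
  by rewrite coefXnM coef_poly ltnS leq_subr.
by move=> i ni; rewrite coef_poly ltnS ni.
Qed.

Lemma fps_coefCM (c : R) f n : fps_coef (fps_of_poly c%:P * f) n = c * fps_coef f n.
Proof.
rewrite (coef_fps_mul_trunc _ _ (leqnn n)) (coefM_low (q := c%:P) _ (leqnn n)).
  by rewrite coefCM coef_poly ltnSn.
by move=> i ni; rewrite coef_poly ltnS ni.
Qed.

Lemma coef_fps_trunc_exp N f k n : (n <= N)%N ->
  fps_coef (f ^+ k) n = (fps_trunc N f ^+ k)`_n.
Proof.
elim: k n => [|k IH] n nN; first by rewrite !expr0 coef1.
rewrite !exprS fps_coefM coefM; apply: eq_bigr => i _.
rewrite IH ?(leq_trans (leq_subr _ _))// coef_poly ltnS.
by rewrite (leq_trans _ nN)// leq_ord.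
Qed.

Lemma fps_mul_eq0 f g : fps_coef f 0 = 1 -> f * g = 0 -> g = 0.
Proof.
move=> f0 fg; apply: fpsP => n; rewrite fps_coef0.
elim/ltn_ind: n => n IH; have := congr1 (fun f => fps_coef f n) fg.
rewrite fps_coefM big_ord_recl f0 mul1r subn0 big1 ?addr0// => i _.
have := ltn_ord i; rewrite lift0 => lin.
by rewrite IH ?mulr0//; lia.
Qed.

End FpsRing.

(* The operator [u d/du], for series in the variable [s] with [u = s ^+ 2]. *)
Definition fps_theta (R : fieldType) (f : fps R) : fps R :=
  Fps (fun n => n%:R / 2 * fps_coef f n).

Section FpsTheta.
Variable R : realFieldType.
Implicit Types f g : fps R.

Fact fps_theta_is_zmod_morphism : zmod_morphism (@fps_theta R).
Proof. by move=> f g; apply: fpsP => n /=; rewrite mulrBr. Qed.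

HB.instance Definition _ :=
  GRing.isZmodMorphism.Build (fps R) (fps R) (@fps_theta R)
    fps_theta_is_zmod_morphism.

Lemma fps_coef_theta f n : fps_coef (fps_theta f) n = n%:R / 2 * fps_coef f n.
Proof. by []. Qed.

Lemma fps_coef_natM m f n : fps_coef (m%:R * f) n = m%:R * fps_coef f n.
Proof. by rewrite -fps_coefCM polyC_natr rmorph_nat. Qed.

Lemma fps_thetaM f g : fps_theta (f * g) = fps_theta f * g + f * fps_theta g.
Proof.
apply: fpsP => n; rewrite fps_coefD !fps_coefM /= -big_split /= mulr_sumr.
apply: eq_bigr => i _.
have -> : n%:R = i%:R + (n - i)%N%:R :> R by rewrite -natrD subnKC// -ltnS.
by field.
Qed.

Lemma fps_theta1 : fps_theta (1 : fps R) = 0.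
Proof.
by apply: fpsP => -[|n] /=; rewrite ?mul0r ?mulr0.
Qed.

Lemma fps_thetaX f n : fps_theta (f ^+ n.+1) = n.+1%:R * f ^+ n * fps_theta f.
Proof.
elim: n => [|n IH]; first by rewrite expr1 expr0 !mul1r.
by rewrite exprS fps_thetaM IH -[in RHS]natr1 exprS; ring.
Qed.

Lemma fps_theta_poly (p : {poly R}) :
  fps_theta (fps_of_poly p) = fps_of_poly (2^-1 *: ('X * p^`())).
Proof.
apply: fpsP => -[|n] /=; rewrite coefZ coefXM ?mul0r ?mulr0//=.
by rewrite coef_deriv -mulr_natr; ring.
Qed.

End FpsTheta.

(** * Algebraic independence of the Bessel functions *)

(* With [u = s ^+ 2], [bessel0] is [sum_n u ^ n / n!^2 = I_0(2 s)] and
   [bessel1] is [I_1(2 s)]. *)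
Definition bessel0 (R : fieldType) : fps R :=
  Fps (fun n => if odd n then 0 else ((n./2)`!%:R ^- 2)).
Definition bessel1 (R : fieldType) : fps R :=
  Fps (fun n => n.+1%:R / 2 * fps_coef (bessel0 R) n.+1).

Section Bessel.
Variable R : realFieldType.
Local Notation A := (bessel0 R).
Local Notation C := (bessel1 R).
Local Notation s := (fps_of_poly ('X : {poly R})).

Lemma fps_coefsM (f : fps R) n :
  fps_coef (s * f) n = if n is m.+1 then fps_coef f m else 0.
Proof. by have := fps_coefXnM 1 f n; rewrite expr1 => ->; case: n => [|n]; rewrite ?subn1. Qed.

Lemma theta_bessel0 : fps_theta A = s * C.
Proof. by apply: fpsP => -[|n]; rewrite fps_coefsM//= !mul0r. Qed.

Lemma theta_bessel1 : fps_theta C = s * A - fps_of_poly (2^-1)%:P * C.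
Proof.
apply: fpsP => n; rewrite fps_coefD fps_coefN fps_coefsM fps_coefCM /=.
case: n => [|n] /=; first by rewrite !(mul0r, mulr0) subrr.
rewrite negbK; case: ifPn => [_|]; first by rewrite !mulr0 subrr.
move=> /negPf on; rewrite -(odd_double_half n) on add0n doubleK.
move: n./2 => m; rewrite factS natrM -[m.*2.+2]/(m.+1.*2) -(muln2 m.+1) natrM.
have f0 : m`!%:R != 0 :> R by rewrite pnatr_eq0 -lt0n fact_gt0.
have m0 : m%:R + 1 != 0 :> R by rewrite natr1 pnatr_eq0.
rewrite -[in LHS]natr1 -(muln2 m) natrM -!natr1; field.
by rewrite f0 m0.
Qed.

Lemma bessel0_0 : fps_coef A 0 = 1.
Proof. by rewrite /= fact0 expr1n invr1. Qed.

(* [p] stands for the form [sum_k p`_k A^(n-k) C^k] of degree [n] over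
   [R[s]], and [form_theta] is the action of [theta] on such forms. *)
Definition form_eval n (p : {poly {poly R}}) : fps R :=
  \sum_(k < n.+1) fps_of_poly p`_k * (A ^+ (n - k) * C ^+ k).

Definition form_theta n (p : {poly {poly R}}) : {poly {poly R}} :=
  \poly_(k < n.+1) (2^-1 *: ('X * (p`_k)^`()) - (k%:R / 2) *: p`_k
    + 'X * ((n.+1 - k)%N%:R%:P * ('X * p)`_k + k.+1%:R%:P * p`_k.+1)).

Lemma form_evalD n p q : form_eval n (p + q) = form_eval n p + form_eval n q.
Proof.
rewrite -big_split /=; apply: eq_bigr => k _.
by rewrite coefD rmorphD mulrDl.
Qed.

Lemma form_evalCM n (c : {poly R}) p :
  form_eval n (c%:P * p) = fps_of_poly c * form_eval n p.
Proof.
rewrite mulr_sumr; apply: eq_bigr => k _.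
by rewrite coefCM rmorphM /= mulrA.
Qed.

Lemma form_eval_sum n (I : Type) (r : seq I) (P : pred I) F :
  form_eval n (\sum_(i <- r | P i) F i) = \sum_(i <- r | P i) form_eval n (F i).
Proof.
apply: (big_morph (form_eval n) (form_evalD n)).
by rewrite /form_eval big1// => k _; rewrite coef0 rmorph0 mul0r.
Qed.

(** The truncated [n - k.+1] and [k.-1] are harmless: for [k = n] and [k = 0] these terms carry the
    factor 0. *)
Lemma theta_monomial n k : (k <= n)%N ->
  fps_theta (A ^+ (n - k) * C ^+ k) =
    (n - k)%N%:R * s * (A ^+ (n - k.+1) * C ^+ k.+1)
    + k%:R * s * (A ^+ (n.+1 - k) * C ^+ k.-1)
    - fps_of_poly (k%:R / 2)%:P * (A ^+ (n - k) * C ^+ k).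
Proof.
move=> kn; rewrite fps_thetaM.
have -> : fps_theta (A ^+ (n - k)) = (n - k)%N%:R * s * A ^+ (n - k.+1) * C.
  rewrite subnS; case: (n - k)%N => [|m]; first by rewrite expr0 fps_theta1 !mul0r.
  by rewrite fps_thetaX theta_bessel0 /=; ring.
have -> : A ^+ (n - k) * fps_theta (C ^+ k) = k%:R * s * (A ^+ (n.+1 - k) * C ^+ k.-1)
    - fps_of_poly (k%:R / 2)%:P * (A ^+ (n - k) * C ^+ k).
  case: k kn => [|m] kn.
    by rewrite expr0 fps_theta1 /= !mul0r polyC0 rmorph0 mul0r subr0 mulr0.
  rewrite fps_thetaX theta_bessel1 /= subSn// polyCM rmorphM /= !exprS.
  rewrite polyC_natr rmorph_nat; ring.
by rewrite exprS; ring.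
Qed.

Lemma form_evalX n (p : {poly {poly R}}) : (size p <= n.+1)%N ->
  form_eval n (form_theta n p) = fps_theta (form_eval n p).
Proof.
move=> sp; rewrite raddf_sum /=.
under [RHS]eq_bigr => k _.
  rewrite fps_thetaM theta_monomial -1?ltnS// fps_theta_poly.
  rewrite mulrBr mulrDr. over.
rewrite !big_split /= sumrN.
have -> : \sum_(i < n.+1) fps_of_poly p`_i *
      ((n - i)%N%:R * s * (A ^+ (n - i.+1) * C ^+ i.+1)) =
    \sum_(i < n.+1) fps_of_poly ('X * ((n.+1 - i)%N%:R%:P * ('X * p)`_i)) *
      (A ^+ (n - i) * C ^+ i).
  rewrite [RHS]big_ord_recl coefXM /= !(mulr0, rmorph0, mul0r) add0r.
  rewrite big_ord_recr subnn /= !(mulr0, mul0r) addr0; apply: eq_bigr => i _.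
  rewrite /bump leq0n add1n coefXM /= subSS !rmorphM /= polyC_natr rmorph_nat; ring.
have -> : \sum_(i < n.+1) fps_of_poly p`_i *
      (i%:R * s * (A ^+ (n.+1 - i) * C ^+ i.-1)) =
    \sum_(i < n.+1) fps_of_poly ('X * (i.+1%:R%:P * p`_i.+1)) *
      (A ^+ (n - i) * C ^+ i).
  rewrite big_ord_recl !(mul0r, mulr0) add0r.
  rewrite [RHS]big_ord_recr [p`_n.+1]nth_default//= !(mulr0, rmorph0, mul0r).
  rewrite addr0; apply: eq_bigr => i _.
  rewrite /bump leq0n add1n /= subSS !rmorphM /= polyC_natr rmorph_nat; ring.
rewrite -sumrN -!big_split /=; apply: eq_bigr => k _.
rewrite coef_poly ltn_ord mulrDr !rmorphD rmorphN /= -[(k%:R / 2) *: _]mul_polyC.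
by rewrite rmorphM /=; ring.
Qed.

Lemma size_form_theta n (p : {poly {poly R}}) : (size (form_theta n p) <= n.+1)%N.
Proof. exact: size_poly. Qed.

Lemma coef_form_theta n (p : {poly {poly R}}) k a : (k <= n)%N ->
  (form_theta n p)`_k`_a = (a%:R - k%:R) / 2 * p`_k`_a
    + (if a is a'.+1 then (n.+1 - k)%N%:R * ('X * p)`_k`_a' + k.+1%:R * p`_k.+1`_a'
       else 0).
Proof.
move=> kn; rewrite coef_poly ltnS kn coefD coefB !coefZ !coefXM coef_deriv.
case: a => [|a] /=; first by rewrite !(mulr0, mul0r); ring.
by rewrite coefD !coefCM -mulr_natr; ring.
Qed.

End Bessel.

(* [c k a] is the coefficient of [s^a A^(n-k) C^k] in a form which [theta]
   multiplies by [lam]; no such form of positive degree exists.  The lowest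
   order [b] in [s] forces [lam`_0 = (b - n) / 2]; in the highest order [t],
   pairing with the weights [1 / 'C(n, k)], for which [euler] is symmetric,
   expresses [0] as a sum of nonnegative terms. *)
Section Darboux.
Variables (R : realFieldType) (n : nat) (c : nat -> nat -> R) (lam : {poly R}).
Variable amax : nat.
Hypothesis n_gt0 : (0 < n)%N.
Hypothesis c_deg : forall k a, (n < k)%N -> c k a = 0.
Hypothesis c_bound : forall k a, (amax < a)%N -> c k a = 0.

(** The derivation [C d/dA + A d/dC] on forms of degree [n]: it is the part of [theta] that raises
    the order in [s]. *)
Definition euler k a : R :=
  (n.+1 - k)%N%:R * (if k is k'.+1 then c k' a else 0) + k.+1%:R * c k.+1 a.

Hypothesis c_eq : forall k a, (k <= n)%N ->
  (a%:R - k%:R) / 2 * c k a + (if a is a'.+1 then euler k a' else 0) =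
  \sum_(j < a.+1) lam`_j * c k (a - j)%N.

(** The matrix is tridiagonal, and [(n - k) 'C(n, k) = (k+1) 'C(n, k+1)] makes it symmetric for the
    weights [1 / 'C(n, k)]. *)
Lemma euler_sym (f g : nat -> R) :
  \sum_(k < n.+1) ((n.+1 - k)%N%:R * (if (k : nat) is k'.+1 then f k' else 0)
      + k.+1%:R * (if (k < n)%N then f k.+1 else 0)) * g k / 'C(n, k)%:R =
  \sum_(k < n.+1) ((n.+1 - k)%N%:R * (if (k : nat) is k'.+1 then g k' else 0)
      + k.+1%:R * (if (k < n)%N then g k.+1 else 0)) * f k / 'C(n, k)%:R.
Proof.
have E (u v : nat -> R) :
  \sum_(k < n.+1) ((n.+1 - k)%N%:R * (if (k : nat) is k'.+1 then u k' else 0)) * v k / 'C(n, k)%:R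
  = \sum_(k < n.+1) (k.+1%:R * (if (k < n)%N then v k.+1 else 0)) * u k / 'C(n, k)%:R.
  rewrite big_ord_recl /= !(mulr0, mul0r) add0r.
  rewrite [RHS]big_ord_recr /= ltnn !(mulr0, mul0r) addr0.
  apply: eq_bigr => k _; rewrite /bump leq0n add1n /= ltn_ord subSS.
  have Cp m : (m <= n)%N -> 'C(n, m)%:R != 0 :> R.
    by move=> mn; rewrite pnatr_eq0 -lt0n bin_gt0.
  have := mul_bin_left n k => /(congr1 (fun m => m%:R : R)).
  rewrite !natrM => H; have C1 := Cp _ (ltn_ord k); have C2 := Cp _ (ltnW (ltn_ord k)).
  have k1 : k.+1%:R != 0 :> R by rewrite pnatr_eq0.
  apply: (mulIf C1); apply: (mulIf C2).
  transitivity ((n - k)%N%:R * u k * v k.+1 * 'C(n, k)%:R); first by field.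
  transitivity (k.+1%:R * v k.+1 * u k * 'C(n, k.+1)%:R); last by field.
  by rewrite mulrAC -mulrA mulrAC; transitivity (((n - k)%N%:R * 'C(n, k)%:R) * (u k * v k.+1)); [ring|rewrite -H; ring].
under eq_bigr => k _ do rewrite !mulrDl.
rewrite big_split /= [in RHS](eq_bigr (fun k : 'I_n.+1 =>
   (n.+1 - k)%N%:R * (if k : nat is k'.+1 then g k' else 0) * f k / 'C(n, k)%:R
   + k.+1%:R * (if (k < n)%N then g k.+1 else 0) * f k / 'C(n, k)%:R)).
  by rewrite big_split /= E -(E g f) addrC.
by move=> k _; rewrite !mulrDl.
Qed.

Lemma darboux k a : c k a = 0.
Proof.
apply/eqP; apply: contraT => ck0.
have kn : (k <= n)%N by rewrite leqNgt; apply: contra ck0 => /c_deg ->.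
pose Pr a := [exists k : 'I_n.+1, c k a != 0].
have exP : exists a, Pr a by exists a; apply/existsP; exists (inord k); rewrite inordK.
have bP i : Pr i -> (i <= amax)%N.
  by move=> /existsP[x cx]; rewrite leqNgt; apply: contra cx => /c_bound ->.
case: (ex_maxnP exP bP) => t /existsP[kt ct] tmax.
case: (ex_minnP exP) => b /existsP[i ci] bmin.
have c_top x y : (t < y)%N -> c x y = 0.
  move=> ty; apply/eqP; apply: contraT => cxy.
  have xn : (x <= n)%N by rewrite leqNgt; apply: contra cxy => /c_deg ->.
  suff : Pr y by move/tmax; rewrite leqNgt ty.
  by apply/existsP; exists (inord x); rewrite inordK.
have c_bot x y : (y < b)%N -> c x y = 0.
  move=> yb; apply/eqP; apply: contraT => cxy.
  have xn : (x <= n)%N by rewrite leqNgt; apply: contra cxy => /c_deg ->.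
  suff : Pr y by move/bmin; rewrite leqNgt yb.
  by apply/existsP; exists (inord x); rewrite inordK.
have bt : (b <= t)%N by rewrite leqNgt; apply: contra ci => /c_top ->.
(* Since [theta] raises the order in [s] by at most one, [lam] has degree at most one: otherwise its
   leading coefficient times [c kt t] would stand alone in order [t + deg lam]. *)
have lam_low j : (1 < j)%N -> lam`_j = 0.
  move=> j1; apply/eqP; apply: contraT => lj.
  have sl : (2 < size lam)%N.
    by rewrite ltnNge; apply: contra lj => sl; rewrite nth_default// (leq_trans sl).
  pose e := (size lam).-2; have e1 : size lam = e.+2 by rewrite /e; lia.
  have e0 : (0 < e)%N by lia.
  have := @c_eq kt (t + e).+1 (leq_ord kt).
  rewrite /euler c_top; last by lia.
  rewrite c_top ?mulr0 ?add0r; last by lia.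
  rewrite (_ : (if _ is k'.+1 then _ else 0) = 0); last first.
    by case: (nat_of_ord kt) => // k'; rewrite c_top//; lia.
  have jj : (e.+1 < (t + e).+2)%N by lia.
  rewrite (bigD1 (Ordinal jj)) //= big1 ?addr0; last first.
    move=> x xj; have {}xj : x != e.+1 :> nat by [].
    case: (ltnP x e.+1) => xs; first by rewrite c_top ?mulr0//; lia.
    by rewrite [lam`_x]nth_default ?mul0r// e1 ltn_neqAle eq_sym xj.
  rewrite subSS addnK mulr0 => /esym/eqP; rewrite mulf_eq0 (negPf ct) orbF.
  have -> : lam`_e.+1 = lead_coef lam by rewrite lead_coefE e1.
  by rewrite lead_coef_eq0 -size_poly_eq0 e1.
have rhsE x y : \sum_(j < y.+1) lam`_j * c x (y - j)%N =
    lam`_0 * c x y + (if y is y'.+1 then lam`_1 * c x y' else 0).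
  rewrite big_ord_recl subn0; congr (_ + _).
  case: y => [|y]; first by rewrite big_ord0.
  rewrite big_ord_recl /= subSS subn0 big1 ?addr0// => j _.
  by rewrite lam_low ?mul0r.
have lam0i : lam`_0 = (b%:R - i%:R) / 2.
  have := @c_eq i b (leq_ord i); rewrite rhsE.
  rewrite (_ : (if b is a'.+1 then euler _ a' else 0) = 0); last first.
    case: (b) c_bot => // b' cb; rewrite /euler cb// (_ : (if _ is _.+1 then _ else 0) = 0) ?mulr0 ?addr0//.
    by case: (nat_of_ord i) => // k'; rewrite cb.
  rewrite (_ : (if b is a'.+1 then _ else 0) = 0); last first.
    by case: (b) c_bot => // b' cb; rewrite cb ?mulr0.
  by rewrite !addr0 => /(mulIf ci).
(* The numbers [(b - x) / 2] are distinct for distinct [x], so the lowest order is carried by a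
   single monomial. *)
have c_bi x : x != i :> nat -> c x b = 0.
  move=> xi; case: (ltnP n x) => [/c_deg //|xn].
  have := @c_eq x b xn; rewrite rhsE.
  rewrite (_ : (if b is a'.+1 then euler _ a' else 0) = 0); last first.
    case: (b) c_bot => // b' cb; rewrite /euler cb// (_ : (if _ is _.+1 then _ else 0) = 0) ?mulr0 ?addr0//.
    by case: (x) => // k'; rewrite cb.
  rewrite (_ : (if b is a'.+1 then _ else 0) = 0); last first.
    by case: (b) c_bot => // b' cb; rewrite cb ?mulr0.
  rewrite !addr0 lam0i => /eqP; rewrite -subr_eq0 -mulrBl mulf_eq0 => /orP[|/eqP//].
  rewrite (_ : _ - _ = (i%:R - x%:R) / 2); last by ring.
  rewrite mulf_eq0 invr_eq0 pnatr_eq0 orbF subr_eq0 eqr_nat.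
  by rewrite eq_sym (negPf xi).
(* In row [i + 1] and order [b + 1] the diagonal terms cancel and only [(n - i) c i b] is left. *)
have i_n : i = n :> nat.
  apply/eqP; apply: contraT => i_n.
  have {}i_n : (i < n)%N by move: (ltn_ord i) i_n; lia.
  have := @c_eq i.+1 b.+1 i_n; rewrite rhsE /euler lam0i.
  rewrite !(c_bi i.+1) ?(c_bi i.+2) ?mulr0 ?addr0; [|lia|lia].
  have -> : (b.+1%:R - i.+1%:R) = b%:R - i%:R :> R by rewrite -!natr1; ring.
  rewrite -[RHS]addr0 => /addrI /eqP; rewrite mulf_eq0 (negPf ci) orbF pnatr_eq0.
  by rewrite subSS; lia.
pose p k := c k t.
pose r k := if t is t'.+1 then c k t' else 0.
have top1 x : (x <= n)%N -> euler x t = lam`_1 * p x.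
  by move=> xn; have := @c_eq x t.+1 xn; rewrite rhsE (c_top x t.+1)// !mulr0 !add0r.
have top0 x : (x <= n)%N -> ((t%:R - x%:R) / 2 - lam`_0) * p x =
   lam`_1 * r x - ((n.+1 - x)%N%:R * (if x is x'.+1 then r x' else 0) + x.+1%:R * r x.+1).
  move=> xn; have := @c_eq x t xn; rewrite rhsE /euler /r /p mulrBl.
  by case: (t) => [|t']; case: (x) => [|x'] E; lra.
have sum0 : \sum_(x < n.+1) ((t%:R - x%:R) / 2 - lam`_0) * p x ^+ 2 / 'C(n, x)%:R = 0.
  have Eu x (f : nat -> R) : (x <= n)%N -> f n.+1 = 0 ->
    f x.+1 = (if (x < n)%N then f x.+1 else 0).
    by move=> xn fn; case: ltnP => // nx; rewrite (_ : x = n) //; lia.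
  have rn : r n.+1 = 0 by rewrite /r; case: (t) => // t'; rewrite c_deg.
  have pn : p n.+1 = 0 by rewrite /p c_deg.
  have := euler_sym r p.
  rewrite (eq_bigr (fun x : 'I_n.+1 => lam`_1 * (r x * p x) / 'C(n, x)%:R -
     ((t%:R - x%:R) / 2 - lam`_0) * p x ^+ 2 / 'C(n, x)%:R)); last first.
    move=> x _; rewrite -Eu ?leq_ord// expr2 (mulrA _ (p x)) top0 ?leq_ord//; ring.
  rewrite [RHS](eq_bigr (fun x : 'I_n.+1 => lam`_1 * (r x * p x) / 'C(n, x)%:R)); last first.
    move=> x _; rewrite -(Eu _ p) ?leq_ord//.
    by have := top1 x (leq_ord x); rewrite /euler /p => ->; ring.
  by rewrite sumrB => /eqP; rewrite subr_eq -subr_eq0 opprD addrA subrr add0r oppr_eq0 => /eqP.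
have p0 x : (x < n)%N -> p x = 0.
  move=> xn; have xn1 : (x < n.+1)%N by lia.
  have pos (y : 'I_n.+1) : 0 <= ((t%:R - y%:R) / 2 - lam`_0) * p y ^+ 2 / 'C(n, y)%:R.
    rewrite lam0i i_n divr_ge0// mulr_ge0 ?sqr_ge0//.
    have : (b%:R <= t%:R :> R) by rewrite ler_nat.
    have : (y%:R <= n%:R :> R) by rewrite ler_nat leq_ord.
    lra.
  have := sum0 => /eqP; rewrite psumr_eq0 => [/allP /(_ (Ordinal xn1))|y _]; last exact: pos.
  rewrite mem_index_enum => /(_ isT) /=.
  rewrite mulf_eq0 invr_eq0 pnatr_eq0 mulf_eq0 sqrf_eq0.
  rewrite (gtn_eqF (_ : 0 < 'C(n, x))%N) ?bin_gt0 1?ltnW// orbF.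
  case/orP => [|/eqP //]; rewrite lam0i i_n.
  have : (b%:R <= t%:R :> R) by rewrite ler_nat.
  have : (x%:R < n%:R :> R) by rewrite ltr_nat.
  move=> H1 H2 /eqP H3; exfalso; lra.
have ktn : kt = n :> nat.
  apply/eqP; apply: contraT => H; move: ct; rewrite -/(p kt) p0 ?eqxx//.
  by move: (ltn_ord kt) H; lia.
(* Now [p] is supported at [n], and row [n - 1] of the eigenvector equation reads [n * p n = 0]. *)
have := top1 n.-1; rewrite /euler prednK// (p0 n.-1) ?ltn_predL// mulr0.
rewrite (_ : (if n.-1 is k'.+1 then _ else 0) = 0); last first.
  by case E: n.-1 => [//|m]; apply: p0; lia.
rewrite mulr0 add0r => /(_ (leq_pred n)) /eqP.
by rewrite mulf_eq0 pnatr_eq0 /p -{2}ktn (negPf ct) orbF (gtn_eqF n_gt0).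
Qed.

End Darboux.

Lemma form_eval_lead0 (R : realFieldType) n (p : {poly {poly R}}) : p`_n.+1 = 0 ->
  form_eval n.+1 p = bessel0 R * form_eval n p.
Proof.
move=> pn; rewrite /form_eval big_ord_recr /= pn rmorph0 mul0r addr0 mulr_sumr.
by apply: eq_bigr => k _; rewrite subSn -1?ltnS// exprS; ring.
Qed.

(* A relation with leading coefficient of least degree generates, by Euclidean
   division of leading coefficients, all relations of the same degree; hence
   [theta] multiplies it by a polynomial, which [darboux] forbids. *)
Theorem form_eval_inj (R : realFieldType) n (p : {poly {poly R}}) :
  (size p <= n.+1)%N -> form_eval n p = 0 -> p = 0.
Proof.
elim: n p => [|n IH] p sp ep.
  move: ep; rewrite /form_eval big_ord1 !expr0 !mulr1 => p0.
  have p00 : p`_0 = 0 by apply: fps_of_poly_inj; rewrite rmorph0.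
  by rewrite (size1_polyC sp) p00.
apply/eqP; apply: contraT => p0.
(* Without the pure power of [C] the form is divisible by [A], a unit since its constant term is 1,
   and the induction hypothesis applies to the quotient. *)
have lead0 (q : {poly {poly R}}) : (size q <= n.+2)%N -> form_eval n.+1 q = 0 ->
    q`_n.+1 = 0 -> q = 0.
  move=> sq eq qn; apply: IH; last first.
    by apply: (fps_mul_eq0 (bessel0_0 R)); rewrite -form_eval_lead0.
  apply/leq_sizeP => j; rewrite leq_eqVlt => /orP[/eqP <- //|nj].
  by rewrite nth_default// (leq_trans sq).
pose Pr m := exists q : {poly {poly R}}, [/\ q != 0, (size q <= n.+2)%N,
   form_eval n.+1 q = 0 & size q`_n.+1 = m].
have exP : exists m, `[< Pr m >].
  by exists (size p`_n.+1); apply/asboolP; exists p.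
case: (ex_minnP exP) => m /asboolP[q [q0 sq eq sqm]] mmin.
set d := form_theta n.+1 q.
have sd : (size d <= n.+2)%N by exact: size_form_theta.
have ed : form_eval n.+1 d = 0 by rewrite form_evalX// eq raddf0.
have qn0 : q`_n.+1 != 0 by apply: contra q0 => /eqP /lead0 ->.
pose lam := d`_n.+1 %/ q`_n.+1.
have dq : d = lam%:P * q.
  apply/eqP; rewrite -subr_eq0; apply: contraT => r0.
  have sr : (size (d - lam%:P * q)%R <= n.+2)%N.
    rewrite (leq_trans (size_polyD _ _))// geq_max sd size_polyN mul_polyC.
    exact: leq_trans (size_scale_leq _ _) sq.
  have er : form_eval n.+1 (d - lam%:P * q) = 0.
    by rewrite -mulNr -polyCN form_evalD form_evalCM ed eq mulr0 addr0.
  have rn : (d - lam%:P * q)`_n.+1 = d`_n.+1 %% q`_n.+1.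
    by rewrite coefB coefCM {1}(divp_eq d`_n.+1 q`_n.+1) addrC addKr.
  have : Pr (size (d`_n.+1 %% q`_n.+1)) by exists (d - lam%:P * q); rewrite rn.
  by move=> /asboolP /mmin; rewrite -sqm leqNgt ltn_modp qn0.
suff : q = 0 by move=> q_0; rewrite q_0 eqxx in q0.
pose amax := (\max_(k < n.+2) size (q`_k)%R)%N.
apply/polyP => k; apply/polyP => a; rewrite !coef0.
apply: (@darboux R n.+1 (fun k a => q`_k`_a) lam amax) => // {k a}k a.
- by move=> nk; rewrite (nth_default _ (leq_trans sq nk)) coef0.
- move=> ak; case: (ltnP k n.+2) => kn; last first.
    by rewrite (nth_default _ (leq_trans sq kn)) coef0.
  rewrite nth_default// (leq_trans _ (ltnW ak))//.
  exact: (leq_bigmax (Ordinal kn)).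
move=> kn; transitivity (d`_k`_a).
  rewrite coef_form_theta//; congr (_ + _); case: a => // a.
  by rewrite /euler coefXM; case: k kn => //= _; rewrite coef0.
by rewrite dq coefCM coefM.
Qed.

(** * The explicit banana operator *)

(* [sum_j u^j symop N k j (theta)] is the operator [L_k] in the recursion
   [L_(k+1) = theta L_k - k (N+1-k) u L_(k-1)] of Bronstein, Mulders and Weil
   for the [N]-th symmetric power of the Bessel operator [theta^2 - u]. *)
Fixpoint symop (R : realFieldType) (N k j : nat) : {poly R} :=
  if k is k'.+1 then
    ('X + j%:R%:P) * symop R N k' j -
    (if k' is k''.+1 then
       if j is j'.+1 then (k' * (N.+1 - k'))%:R *: symop R N k'' j' else 0
     else 0)
  else (j == 0)%:R%:P.

Section Symop.
Variables (R : realFieldType) (N : nat).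
Local Notation A := (bessel0 R).
Local Notation V := (fps_of_poly ('X : {poly R}) * bessel1 R).
Local Notation P := (symop R N).

Lemma symopS k j : P k.+1 j = ('X + j%:R%:P) * P k j -
  (if j is j'.+1 then (k * (N.+1 - k))%:R *: P k.-1 j' else 0).
Proof. by case: k => [|k]; case: j => [|j] //=; rewrite scale0r. Qed.

Lemma symop0 k : P k 0 = 'X^k.
Proof.
by elim: k => [|k IH] //; rewrite symopS IH subr0 addr0 exprS.
Qed.

(** In the recursion a factor [u] takes the place of two factors [theta]. When [k < 2 j] the bound
    is 0 and the coefficient vanishes. *)
Lemma size_symop k j : (size (P k j) <= k.+1 - j.*2)%N.
Proof.
elim/ltn_ind: k j => -[|k] IH j.
  by case: j => [|j]; rewrite ?size_polyC//= ?oner_eq0 ?eqxx.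
rewrite symopS (leq_trans (size_polyD _ _))// geq_max size_polyN; apply/andP; split.
  case: (eqVneq (P k j) 0) => [-> |P0]; first by rewrite mulr0 size_poly0.
  have sX : size ('X + j%:R%:P : {poly R}) = 2%N by exact: size_XaddC.
  have := IH k (ltnSn k) j; rewrite size_mul// -?size_poly_eq0 ?sX//=.
  move: P0; rewrite -size_poly_gt0; move: (size _) => p; lia.
case: j => [|j]; first by rewrite size_poly0.
case: k IH => [|k] IH; first by rewrite mul0n scale0r size_poly0.
rewrite (leq_trans (size_scale_leq _ _))//=.
have := IH k (ltnW (ltnSn k.+1)) j; move: (size _) => p; lia.
Qed.

(** With [V = theta A] and [theta V = s^2 A], applying [theta] to [N^_k A^(N-k) V^k] yields the next
    such term plus [k (N+1-k) u] times the previous one, which is what the recursion subtracts. Only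
    even orders in [s] are recorded, and at [k = N+1] the falling factorial is 0. *)
Lemma symop_action k m : (k <= N.+1)%N ->
  \sum_(j < m.+1) (P k j).[(m - j)%N%:R] * fps_coef (A ^+ N) (m - j).*2 =
  fps_coef ((N ^_ k)%:R * (A ^+ (N - k) * V ^+ k)) m.*2.
Proof.
elim/ltn_ind: k m => -[|k] IH m kN.
  rewrite ffactn0 subn0 expr0 mulr1 mul1r big_ord_recl big1 => [|i _].
    by rewrite [P 0 _]/= hornerC subn0 mul1r addr0.
  by rewrite [P 0 _]/= hornerC mul0r.
pose G k m := \sum_(j < m.+1) (P k j).[(m - j)%N%:R] * fps_coef (A ^+ N) (m - j).*2.
have -> : \sum_(j < m.+1) (P k.+1 j).[(m - j)%N%:R] * fps_coef (A ^+ N) (m - j).*2 =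
   m%:R * G k m - (if m is m'.+1 then (k * (N.+1 - k))%:R * G k.-1 m' else 0).
  under eq_bigr => j _.
    rewrite symopS hornerD hornerN mulrBl hornerM hornerD hornerX hornerC.
    rewrite -natrD subnK -1?ltnS// -mulrA. over.
  rewrite sumrB -mulr_sumr; congr (_ - _); case: m => [|m].
    by rewrite big_ord1 /= hornerC mul0r.
  rewrite big_ord_recl /= hornerC mul0r add0r mulr_sumr; apply: eq_bigr => j _.
  by rewrite /bump leq0n add1n subSS hornerZ mulrA.
have tV : fps_theta V = fps_of_poly 'X ^+ 2 * A.
  rewrite fps_thetaM theta_bessel1 fps_theta_poly derivX mulr1.
  by rewrite -mul_polyC rmorphM /=; ring.
have -> : ((N ^_ k.+1)%:R * (A ^+ (N - k.+1) * V ^+ k.+1)) =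
  fps_theta ((N ^_ k)%:R * (A ^+ (N - k) * V ^+ k)) -
  (k * (N.+1 - k))%:R * (fps_of_poly 'X ^+ 2 *
     ((N ^_ k.-1)%:R * (A ^+ (N - k.-1) * V ^+ k.-1))).
  have tn (n : nat) f : fps_theta (n%:R * f) = n%:R * fps_theta f :> fps R.
    by rewrite !mulr_natl raddfMn.
  rewrite tn fps_thetaM.
  have -> : fps_theta (A ^+ (N - k)) = (N - k)%N%:R * A ^+ (N - k.+1) * V.
    rewrite subnS; case: (N - k)%N => [|n]; first by rewrite expr0 fps_theta1 !mul0r.
    by rewrite fps_thetaX theta_bessel0.
  rewrite ffactnSr natrM.
  case: k kN {IH G} => [|k] kN.
    by rewrite !mul0n !mul0r subr0 !expr0 fps_theta1; ring.
  rewrite fps_thetaX tV /= natrM subSS ffactnSr natrM.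
  have -> : (N - k)%N = (N - k.+1).+1 by lia.
  by rewrite !exprS; ring.
rewrite fps_coefD fps_coefN; congr (_ - _).
  rewrite fps_coef_theta -IH//; last exact: ltnW.
  by rewrite -muln2 natrM mulfK// pnatr_eq0.
rewrite fps_coef_natM -rmorphXn fps_coefXnM.
case: m => [|m]; first by rewrite mulr0.
rewrite doubleS (_ : (m.*2.+2 < 2)%N = false)// !subSS subn0 -IH//; last first.
- by case: (k) kN => //= k' /ltnW/ltnW.
- by case: (k).
Qed.

Lemma symop_annihilates m :
  \sum_(j < m.+1) (P N.+1 j).[(m - j)%N%:R] * fps_coef (A ^+ N) (m - j).*2 = 0.
Proof.
by rewrite symop_action// ffact_small// mul0r fps_coef0.
Qed.

(* The weights [k (N+1-k)] are invariant under [k -> N+1-k], so the operator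
   and its formal adjoint are read off the same continuant; the alternating
   sum below telescopes. *)
Lemma symop_adjoint j :
  P N.+1 j \Po (- 'X - j%:R%:P) = (-1) ^+ N.+1 *: P N.+1 j.
Proof.
pose Y : {poly R} := - 'X - j%:R%:P.
pose beta k : {poly R} := (k * (N.+1 - k))%:R.
(* [T p q] is the coefficient of [u^j] in [adj(L_q) L_p], and [U p q] the one in [adj(L_q) u L_p],
   where [adj] is the formal adjoint. Then [step] says that [adj(L_q) theta L_p + adj(theta L_q) L_p
   = 0], and [tele] moves all factors from one side to the other. *)
pose T p q := \sum_(i < j.+1) P p i * (P q (j - i) \Po Y).
pose U p q := \sum_(i < j) P p i * (P q (j.-1 - i) \Po Y).
have XP p i : ('X + i%:R%:P) * P p i = P p.+1 i +
    (if i is i'.+1 then beta p * P p.-1 i' else 0).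
  by rewrite symopS; case: i => [|i]; rewrite /beta ?scaler_nat ?mulr_natl; ring.
have YP p i : (Y + i%:R%:P) * (P p i \Po Y) = P p.+1 i \Po Y +
    (if i is i'.+1 then beta p * (P p.-1 i' \Po Y) else 0).
  have := congr1 (comp_poly Y) (XP p i).
  rewrite comp_polyM !comp_polyD comp_polyX comp_polyC => ->; congr (_ + _).
  case: i => [|i]; first by rewrite comp_poly0.
  by rewrite comp_polyM /beta -polyC_natr comp_polyC.
have step p q : T p.+1 q + beta p * U p.-1 q + (T p q.+1 + beta q * U p q.-1) = 0.
  have -> : T p.+1 q + beta p * U p.-1 q =
      \sum_(i < j.+1) ('X + i%:R%:P) * P p i * (P q (j - i) \Po Y).
    under [RHS]eq_bigr => i _ do rewrite XP mulrDl.
    rewrite big_split /= [X in _ = _ + X]big_ord_recl mul0r add0r mulr_sumr.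
    congr (_ + _); apply: eq_bigr => i _.
    rewrite /= /bump leq0n add1n mulrA; congr (_ * (P q _ \Po Y)); lia.
  have -> : T p q.+1 + beta q * U p q.-1 =
      \sum_(i < j.+1) P p i * ((Y + (j - i)%N%:R%:P) * (P q (j - i) \Po Y)).
    under [RHS]eq_bigr => i _ do rewrite YP mulrDr.
    rewrite big_split /= [X in _ = _ + X]big_ord_recr /= subnn mulr0 addr0 mulr_sumr.
    congr (_ + _); apply: eq_bigr => i _ /=.
    have -> : (j - i)%N = (j.-1 - i).+1 by have := ltn_ord i; lia.
    by ring.
  rewrite -big_split big1// => i _ /=.
  rewrite /Y; have -> : j%:R%:P = i%:R%:P + (j - i)%N%:R%:P :> {poly R}.
    by rewrite -polyCD -natrD subnKC// -ltnS.
  by ring.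
have tele p : (p <= N.+1)%N ->
    T p (N.+1 - p)%N + beta p * U p.-1 (N - p)%N = (-1) ^+ p * T 0 N.+1.
  elim: p => [|p IH] pN; first by rewrite subn0 /beta mul0n mul0r addr0 mul1r.
  have -> : (N.+1 - p.+1 = N - p)%N by lia.
  have := step p (N - p)%N; have := IH (ltnW pN).
  have -> : (N.+1 - p = (N - p).+1)%N by lia.
  have -> : beta (N - p)%N = beta p.+1 by rewrite /beta; congr (_%:R); lia.
  have -> : ((N - p).-1 = N - p.+1)%N by lia.
  move=> E S; rewrite exprS -mulrA mulN1r -E; apply/eqP.
  by rewrite -subr_eq0 opprK -[X in _ == X]S; apply/eqP; ring.
have := tele _ (leqnn N.+1); rewrite subnn /beta subnn muln0 mul0r addr0.
rewrite /T; move: (P N.+1) => Q; rewrite big_ord_recr /= subnn big1 => [|i _].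
  rewrite add0r comp_polyC mulr1 => E; rewrite -mul_polyC [X in _ * X]E.
  rewrite big_ord_recl big1 => [|i _]; last by rewrite /= polyC0 mul0r.
  rewrite /= polyC1 mul1r subn0 addr0 rmorphXn rmorphN1 mulrA.
  by rewrite -expr2 sqrr_sign mul1r.
rewrite (_ : (j - i == 0)%N = false) ?comp_polyC ?mulr0//.
by have := ltn_ord i; lia.
Qed.

End Symop.

Arguments symop : simpl never.

(** * The recurrence for the coefficients of the holomorphic solution *)

Section BananaRecurrence.
Variable R : realType.
Local Notation A := (bessel0 R).

Lemma fps_trunc_bessel0 n :
  fps_trunc n.*2 A = (\poly_(i < n.+1) i`!%:R ^- 2) \Po 'X^2.
Proof.
apply/polyP => i; rewrite coef_comp_poly_Xn// !coef_poly dvdn2 divn2 /=.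
case oi: (odd i) => /=; first by case: ifP.
rewrite (_ : (i < n.*2.+1)%N = (i./2 < n.+1)%N)//.
by have := odd_double_half i; move: (i./2) oi => m; lia.
Qed.

Lemma coef_bessel0X k n : fps_coef (A ^+ k) n.*2 =
  ((\poly_(i < n.+1) i`!%:R ^- 2) ^+ k)`_n.
Proof.
rewrite (coef_fps_trunc_exp _ _ (leqnn _)) fps_trunc_bessel0 -rmorphXn /=.
by rewrite coef_comp_poly_Xn// dvdn2 odd_double divn2 doubleK.
Qed.

Lemma coef_bessel0X_odd k n : odd n -> fps_coef (A ^+ k) n = 0.
Proof.
move=> on; rewrite (@coef_fps_trunc_exp _ n.*2) ?fps_trunc_bessel0; last first.
  by rewrite -addnn leq_addr.
by rewrite -rmorphXn /= coef_comp_poly_Xn// dvdn2 on.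
Qed.

Lemma banana_coefE l n :
  banana_coef R l n = n`!%:R ^+ 2 * fps_coef (A ^+ l.+1) n.*2.
Proof.
rewrite coef_bessel0X /banana_coef.
rewrite -[l.+1 in RHS]card_ord -prodr_const poly_def bigA_distr_bigA /=.
rewrite coef_sum mulr_sumr big_mkcond /=; apply: eq_bigr => k _.
have -> : \prod_(i < l.+1) ((k i)`!%:R ^- 2 *: 'X^(k i)) =
    (\prod_i (k i)`!%:R) ^- 2 *: 'X^(\sum_i k i) :> {poly R}.
  rewrite scaler_prod -prodrXr; congr (_ *: _).
  by rewrite -prodrXl -prodfV.
rewrite coefZ coefXn eq_sym; case: eqP => _; last by rewrite !mulr0.
by rewrite mulr1 expr_div_n.
Qed.

(* Passing from the coefficients [a_n] of [I_0^(l+1)] to [n!^2 a_n] turns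
   [sum_j u^j symop j (theta)] into [theta^2 sum_j z^j bop j (theta)]. *)
Definition bop (l j : nat) : {poly R} :=
  if j is j'.+1 then
    symop R l.+1 l.+2 j * (\prod_(i < j') ('X + i.+1%:R%:P)) ^+ 2
  else 'X^l.

Lemma prod_XaddnE (p k : nat) :
  p`!%:R * (\prod_(i < k) ('X + i.+1%:R%:P)).[p%:R] = (p + k)`!%:R :> R.
Proof.
rewrite horner_prod; elim: k => [|k IH]; first by rewrite big_ord0 mulr1 addn0.
by rewrite big_ord_recr /= mulrA IH !hornerE -natrD -natrM addnS factS mulnC.
Qed.

Lemma bop_annihilates l m : (0 < l)%N ->
  \sum_(j < m.+1) (bop l j).[(m - j)%N%:R] * banana_coef R l (m - j) = 0.
Proof.
move=> l0; case: m => [|m].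
  by rewrite big_ord1 /= hornerXn expr0n gtn_eqF// mul0r.
have m0 : m.+1%:R != 0 :> R by rewrite pnatr_eq0.
have := symop_annihilates R l.+1 m.+1 => H.
(* The denominator removes the outer [theta^2], which acts in this order as [(m+1)^2]. Order 0,
   where this division is impossible, was settled above by [0 < l]. *)
have E : (m.+1)`!%:R ^+ 2 / m.+1%:R ^+ 2 * (\sum_(j < m.+2)
    (symop R l.+1 l.+2 j).[(m.+1 - j)%N%:R] * fps_coef (A ^+ l.+1) (m.+1 - j).*2) = 0.
  by rewrite H mulr0.
rewrite -[RHS]E mulr_sumr; apply: eq_bigr => -[j jm] _ /=; rewrite banana_coefE.
rewrite mulrA [RHS]mulrA; congr (_ * _); case: j jm => [|j] jm.
  rewrite [bop _ _]/= symop0 !hornerXn subn0 !exprS; field.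
  by [].
have mj : (m - j + j = m)%N by rewrite subnK.
have := prod_XaddnE (m - j) j; rewrite mj => pE.
rewrite [bop _ _]/= subSS hornerM horner_exp factS natrM -pE; field.
by rewrite addrC natr1 m0.
Qed.

(** The extra factors restore the degree lost to [u^j]: [(l + 2 - 2 j) + 2 (j - 1) = l]. *)
Lemma size_bop l j : (size (bop l j) <= l.+1)%N.
Proof.
case: j => [|j]; first by rewrite size_polyXn.
rewrite [bop _ _]/=; set S := symop _ _ _ _.
case: (eqVneq S 0) => [->|S0]; first by rewrite mul0r size_poly0.
have := size_symop R l.+1 l.+2 j.+1; rewrite -/S.
move: (S0); rewrite -size_poly_gt0 => Sp.
have pm : \prod_(i < j) ('X + i.+1%:R%:P) \is @monic R.
  by apply: monic_prod => i _; exact: monicXaddC.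
have sp : size (\prod_(i < j) ('X + i.+1%:R%:P : {poly R})) = j.+1.
  rewrite (eq_bigr (fun i : 'I_j => 'X - (- i.+1%:R)%:P)) => [|i _].
    by rewrite size_prod_XsubC /index_enum -enumT size_enum_ord.
  by rewrite polyCN opprK.
rewrite size_Mmonic// ?monic_exp//.
move: sp; move: (\prod_(i < j) _) pm => P pm sp.
have -> : size (P ^+ 2)%R = j.*2.+1.
  by rewrite expr2 size_Mmonic// ?monic_neq0// sp -addnn addnS addSn.
move: Sp; move: (size _) => s; lia.
Qed.

Lemma bop_eq0 l j : (l.+2 < j.*2)%N -> bop l j = 0.
Proof.
case: j => [|j] // lj; rewrite [bop _ _]/=.
have := size_symop R l.+1 l.+2 j.+1; set S := symop _ _ _ _.
have -> : (l.+3 - j.+1.*2 = 0)%N by lia.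
by rewrite leqn0 size_poly_eq0 => /eqP ->; rewrite mul0r.
Qed.

(** The reflection [x -> -x-j] permutes the factors [x+1, ..., x+j-1] up to signs, and these
    disappear in the square. *)
Lemma bop_adjoint l j : bop l j \Po (- 'X - j%:R%:P) = (-1) ^+ l *: bop l j.
Proof.
case: j => [|j].
  rewrite [bop _ _]/= polyC0 subr0 rmorphXn /= comp_polyX [LHS]exprNn.
  by rewrite -signr_odd mulr_sign -[in RHS]signr_odd scaler_sign.
rewrite [bop _ _]/= comp_polyM symop_adjoint rmorphXn rmorph_prod /=.
rewrite [in LHS](_ : (-1) ^+ l.+2 = (-1) ^+ l); last first.
  by rewrite !exprS !mulN1r opprK.
rewrite -scalerAl; congr (_ *: (_ * _)).
rewrite (eq_bigr (fun i : 'I_j => - ('X + (rev_ord i).+1%:R%:P))); last first.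
  move=> i _; rewrite comp_polyD comp_polyX comp_polyC /=.
  have -> : j.+1%:R%:P = i.+1%:R%:P + (j - i.+1).+1%:R%:P :> {poly R}.
    by rewrite -polyCD -natrD; congr (_%:R%:P); have := ltn_ord i; lia.
  by ring.
rewrite prodrN exprMn -exprM muln2 -signr_odd odd_double mul1r.
by congr (_ ^+ 2); rewrite (reindex_inj rev_ord_inj); apply: eq_bigr => i _; rewrite rev_ordK.
Qed.

End BananaRecurrence.

(** * Iterates of the derivation [C d/dA + A d/dC] on [A^n], which is encoded by the polynomial 1 *)

Definition euler_op (R : realFieldType) (n : nat) (v : {poly R}) : {poly R} :=
  \poly_(k < n.+1) ((n.+1 - k)%N%:R * ('X * v)`_k + k.+1%:R * v`_k.+1).

Section EulerOp.
Variables (R : realFieldType) (n : nat).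
Local Notation N0 := (euler_op n).
Implicit Types v w : {poly R}.

Fact euler_op_is_linear : linear (N0 : {poly R} -> {poly R}).
Proof.
move=> a v w; apply/polyP => k; rewrite coefD coefZ !coef_poly.
case: ifP => _; last by rewrite mulr0 addr0.
by rewrite mulrDr -scalerAr !(coefD, coefZ); ring.
Qed.

HB.instance Definition _ :=
  GRing.isLinear.Build R {poly R} {poly R} _ (N0 : {poly R} -> {poly R}) euler_op_is_linear.

Lemma size_euler_op v : (size (N0 v) <= n.+1)%N.
Proof. exact: size_poly. Qed.

(** For the positive definite pairing with weights [1 / 'C(n, k)] the operator is symmetric, so
    [<N0 v, N0 v> = <N0 (N0 v), v> = 0]. *)
Lemma euler_op_sq0 v : (size v <= n.+1)%N -> N0 (N0 v) = 0 -> N0 v = 0.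
Proof.
move=> sv N2.
have coefE w k : (size w <= n.+1)%N -> (k < n.+1)%N -> (N0 w)`_k =
   (n.+1 - k)%N%:R * (if k is k'.+1 then w`_k' else 0)
      + k.+1%:R * (if (k < n)%N then w`_k.+1 else 0).
  move=> sw kn; rewrite coef_poly kn coefXM; congr (_ * _ + _ * _); first by case: (k).
  by case: ltnP => // nk; rewrite nth_default// (leq_trans sw).
have := euler_sym n (fun k => v`_k) (fun k => (N0 v)`_k).
rewrite (eq_bigr (fun k : 'I_n.+1 => (N0 v)`_k ^+ 2 / 'C(n, k)%:R)); last first.
  by move=> k _; rewrite -coefE//.
rewrite [RHS](eq_bigr (fun k : 'I_n.+1 => (N0 (N0 v))`_k * v`_k / 'C(n, k)%:R)); last first.
  by move=> k _; rewrite -coefE// size_euler_op.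
rewrite N2 [RHS]big1; last by move=> k _; rewrite coef0 !mul0r.
move=> /eqP; rewrite psumr_eq0 => [/allP H|k _]; last by rewrite divr_ge0// sqr_ge0.
apply/polyP => k; rewrite coef0; case: (ltnP k n.+1) => kn; last first.
  by rewrite nth_default// (leq_trans (size_euler_op _)).
have := H (Ordinal kn); rewrite mem_index_enum => /(_ isT) /=.
rewrite mulf_eq0 invr_eq0 pnatr_eq0 sqrf_eq0 (gtn_eqF (_ : 0 < 'C(n, k))%N) ?bin_gt0//.
by rewrite orbF => /eqP.
Qed.

Lemma size_iter_euler_op v k : (size v <= n.+1)%N -> (size (iter k N0 v) <= n.+1)%N.
Proof. by case: k => [|k] //= _; exact: size_euler_op. Qed.

Lemma iter_euler_op_eq0 v k : (size v <= n.+1)%N -> iter k.+1 N0 v = 0 -> N0 v = 0.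
Proof.
move=> sv; elim: k => [|k IH] //= H.
by apply: IH => /=; apply: euler_op_sq0 => //; exact: size_iter_euler_op.
Qed.

Lemma iter_euler_op_sum k (I : Type) (r : seq I) (P : pred I) (F : I -> {poly R}) :
  iter k N0 (\sum_(i <- r | P i) F i) = \sum_(i <- r | P i) iter k N0 (F i).
Proof. by elim: k => //= k ->; rewrite linear_sum. Qed.

Lemma iter_euler_opZ k a v : iter k N0 (a *: v) = a *: iter k N0 v.
Proof. by elim: k => //= k ->; rewrite linearZ. Qed.

Lemma iter_euler_op_triangular k : (k <= n)%N ->
  (size (iter k N0 (1%R : {poly R})) <= k.+1)%N /\ (iter k N0 (1 : {poly R}))`_k != 0.
Proof.
elim: k => [|k IH] kn; first by rewrite /= size_poly1 coef1 oner_eq0.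
have [sk nz] := IH (ltnW kn); split => /=.
  apply/leq_sizeP => j kj; rewrite coef_poly coefXM; case: ifP => // _.
  rewrite (_ : j == 0%N = false); last by case: (j) kj.
  by rewrite !nth_default ?mulr0 ?addr0//; apply: (leq_trans sk); lia.
rewrite coef_poly ltnS kn coefXM /= [_`_k.+2]nth_default; last first.
  exact: leq_trans sk _.
by rewrite mulr0 addr0 mulf_neq0// pnatr_eq0; lia.
Qed.

(** As long as [T <= n] the iterates have distinct degrees, so the coefficients vanish in turn,
    starting from the highest iterate. *)
Lemma iter_euler_op_free_low d T (g : nat -> R) : (T <= n)%N ->
  \sum_(i < d | (i.*2 <= T)%N) g i *: iter (T - i.*2) N0 (1 : {poly R}) = 0 ->
  forall i, (i < d)%N -> (i.*2 <= T)%N -> g i = 0.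
Proof.
move=> Tn sum0; elim/ltn_ind => i IH id iT.
have := congr1 (fun p : {poly R} => p`_(T - i.*2)) sum0.
rewrite coef0 coef_sum (bigD1 (Ordinal id))//= big1 ?addr0 => [|j /andP[jT ji]].
  have [_ nz] := @iter_euler_op_triangular (T - i.*2) (leq_trans (leq_subr _ _) Tn).
  by rewrite coefZ => /eqP; rewrite mulf_eq0 (negPf nz) orbF => /eqP.
case: (ltnP j i) => [ij|ij]; first by rewrite IH// scale0r coef0.
have {}ij : (i < j)%N by rewrite ltn_neqAle ij andbT eq_sym; exact: ji.
have [sz _] := @iter_euler_op_triangular (T - j.*2) (leq_trans (leq_subr _ _) Tn).
by rewrite coefZ nth_default ?mulr0// (leq_trans sz)//; lia.
Qed.

(** For [T > n] the degrees no longer separate the iterates. But all powers of a symmetric operator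
    have the same kernel, so the relation descends to [T = 2 d - 1 <= n], where the degrees do
    separate them. *)
Lemma iter_euler_op_free d T (g : nat -> R) : (d.*2 <= n.+1)%N ->
  \sum_(i < d | (i.*2 <= T)%N) g i *: iter (T - i.*2) N0 (1 : {poly R}) = 0 ->
  forall i, (i < d)%N -> (i.*2 <= T)%N -> g i = 0.
Proof.
move=> dn; case: (leqP T n) => [Tn|nT]; first exact: iter_euler_op_free_low.
case: d dn => [|d] dn sum0 i id _; first by [].
apply: (@iter_euler_op_free_low d.+1 d.*2.+1) => //; last by lia.
pose z := \sum_(i < d.+1) g i *: iter (d.*2 - i.*2) N0 (1 : {poly R}).
have sz : (size z <= n.+1)%N.
  rewrite (leq_trans (size_sum _ _ _))//; apply/bigmax_leqP => j _.
  rewrite (leq_trans (size_scale_leq _ _))// size_iter_euler_op//.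
  by rewrite size_poly1.
have iz k : iter k N0 z = \sum_(i < d.+1) g i *: iter (k + d.*2 - i.*2) N0 (1 : {poly R}).
  rewrite iter_euler_op_sum; apply: eq_bigr => j _.
  rewrite iter_euler_opZ -iterD addnBA//; have := ltn_ord j; lia.
have := iz 1%N; rewrite /= (_ : N0 z = 0) => [H|].
  rewrite [RHS]H [LHS]big_mkcond; apply: eq_bigr => j _; rewrite add1n ifT//.
  have := ltn_ord j; lia.
apply: (@iter_euler_op_eq0 _ (T - d.*2).-1) => //.
rewrite prednK ?iz; last by lia.
rewrite subnK; last by lia.
rewrite -[RHS]sum0 [RHS]big_mkcond; apply: eq_bigr => j _; rewrite ifT//.
have := ltn_ord j; lia.
Qed.

End EulerOp.

(** Each [theta] raises the degree in [s] by at most one, and does so only through [A -> s C] and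
    [C -> s A]; the top coefficient thus sees [euler_op] alone. *)
Lemma coef_iter_form_theta (R : realFieldType) n k :
  (size (iter k (form_theta n) (1%R : {poly {poly R}})) <= n.+1)%N /\
  forall j, (forall a, (k < a)%N -> (iter k (form_theta n) (1%R : {poly {poly R}}))`_j`_a = 0)
    /\ (iter k (form_theta n) (1%R : {poly {poly R}}))`_j`_k = (iter k (euler_op n) (1 : {poly R}))`_j.
Proof.
elim: k => [|k [sk IH]].
  split; first by rewrite /= size_poly1.
  move=> j; rewrite /= !coef1; case: (j == 0%N); split=> [a a0|].
  - by rewrite coef1 gtn_eqF.
  - by rewrite coef1.
  - by rewrite coef0.
  - by rewrite coef0.
split=> [|j]; first exact: size_form_theta.
case: (ltnP n j) => nj.
  have E : (iter k.+1 (form_theta n) (1%R : {poly {poly R}}))`_j = 0.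
    by rewrite nth_default// (leq_trans (size_form_theta _ _)).
  split=> [a _|]; rewrite E coef0// nth_default//.
  exact: leq_trans (size_euler_op _ _) nj.
have XM a : ('X * iter k (form_theta n) (1%R : {poly {poly R}}))`_j`_a =
    if j is j'.+1 then (iter k (form_theta n) (1%R : {poly {poly R}}))`_j'`_a else 0.
  by rewrite coefXM; case: (j); rewrite ?coef0.
split=> [[//|a] ka|] /=; rewrite coef_form_theta// XM.
  rewrite (IH j).1 ?mulr0 ?add0r; last exact: ltnW.
  rewrite (IH j.+1).1// mulr0 addr0.
  by case: (j) => [|j']; rewrite ?mulr0// (IH j').1// mulr0.
rewrite (IH j).1// mulr0 add0r (IH j.+1).2 coef_poly ltnS nj coefXM.
by congr (_ * _ + _); case: (j) => // j'; rewrite (IH j').2.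
Qed.

(** * Uniqueness of annihilating operators of small degree in [z] *)

Section Uniqueness.
Variable R : realType.
Local Notation A := (bessel0 R).

Definition falling (k : nat) : {poly R} := \prod_(r < k) ('X - r%:R%:P).

Lemma horner_falling k m : (falling k).[m%:R] = (m ^_ k)%:R.
Proof.
rewrite horner_prod; elim: k => [|k IH]; first by rewrite big_ord0 ffactn0.
rewrite big_ord_recr /= IH ffactnSr natrM !hornerE.
case: (ltnP m k) => mk; first by rewrite ffact_small// !mul0r.
by rewrite natrB.
Qed.

Lemma falling_neq0 k : falling k != 0.
Proof. by apply: monic_neq0; apply: monic_prod_XsubC. Qed.

Lemma coef_iter_theta k (f : fps R) n :
  fps_coef (iter k (@fps_theta R) f) n = (n%:R / 2) ^+ k * fps_coef f n.
Proof.
elim: k => [|k IH]; first by rewrite mul1r.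
by rewrite iterS fps_coef_theta IH exprS mulrA.
Qed.

(* The component of top degree in [s] of the form associated with the operator
   [sum_i u^i G i (theta)] only involves [euler_op]. *)
Lemma bessel0X_operator_eq0 (N d : nat) (G : nat -> {poly R}) :
  (d.*2 <= N.+1)%N ->
  (forall n, \sum_(i < d | (i <= n)%N)
     (G i).[(n - i)%N%:R] * fps_coef (A ^+ N) (n - i).*2 = 0) ->
  forall i, (i < d)%N -> G i = 0.
Proof.
move=> dN Grec.
pose K := (\max_(i < d) size (G i))%N.
have GK i : (i < d)%N -> (size (G i) <= K)%N.
  by move=> id; exact: (leq_bigmax (Ordinal id)).
pose dl k : {poly {poly R}} := iter k (form_theta N) 1.
pose F : {poly {poly R}} :=
  \sum_(i < d) \sum_(k < K) ((G i)`_k *: 'X^(i.*2))%:P * dl k.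
have evdl k : form_eval N (dl k) = iter k (@fps_theta R) (A ^+ N).
  elim: k => [|k IH].
    rewrite /dl /form_eval /= big_ord_recl big1 => [|j _]; last first.
      by rewrite coef1 /= rmorph0 mul0r.
    by rewrite coef1 rmorph1 subn0 expr0 mul1r mulr1 addr0.
  by rewrite /dl iterS form_evalX ?IH //; case: (coef_iter_form_theta R N k).
have evF : form_eval N F = 0.
  apply: fpsP => m; rewrite fps_coef0 form_eval_sum fps_coef_sum.
  under eq_bigr => i _.
    rewrite form_eval_sum fps_coef_sum.
    under eq_bigr => k _ do rewrite form_evalCM evdl -mul_polyC rmorphM -mulrA
       fps_coefCM fps_coefXnM coef_iter_theta.
    over.
  case om: (odd m).
    rewrite big1 // => i _; rewrite big1 // => k _; case: ltnP => im; rewrite ?mulr0//.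
    by rewrite coef_bessel0X_odd ?mulr0// oddB// odd_double om.
  have {om}mE : m = m./2.*2 by rewrite -[LHS]odd_double_half om.
  rewrite mE; move: m./2 => n; rewrite -[RHS](Grec n) [RHS]big_mkcond.
  apply: eq_bigr => -[i id] _ /=; case: (leqP i n) => ni; last first.
    by rewrite big1// => k _; rewrite ifT ?mulr0// ltn_double.
  rewrite (horner_coef_wide _ (GK i id)) mulr_suml; apply: eq_bigr => k _.
  rewrite ifF; last by rewrite ltnNge leq_double ni.
  by rewrite -doubleB -[in (n - i).*2%:R]muln2 natrM mulfK ?pnatr_eq0// mulrA.
have F0 : F = 0.
  apply: (@form_eval_inj _ N) => //.
  rewrite (leq_trans (size_sum _ _ _))//; apply/bigmax_leqP => i _.
  rewrite (leq_trans (size_sum _ _ _))//; apply/bigmax_leqP => k _.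
  rewrite mul_polyC (leq_trans (size_scale_leq _ _))//.
  by case: (coef_iter_form_theta R N k).
(* Descending induction on the total degree [T = k + 2 i] in [s], with [m] as fuel. In degree [T],
   terms with [k + 2 i < T] are too short and those with [k + 2 i > T] are already zero, so the
   remaining ones form a relation between iterates of [euler_op]. *)
suff H T m : (K + d.*2 <= T + m)%N -> forall i, (i < d)%N -> (i.*2 <= T)%N -> (G i)`_(T - i.*2) = 0.
  move=> i id; apply/polyP => k; rewrite coef0.
  by have := H (k + i.*2)%N _ (leq_addl _ _) i id (leq_addl _ _); rewrite addnK.
elim: m T => [|m IH] T KT.
  move=> i id iT; rewrite nth_default// (leq_trans (GK _ id))//.
  by move: KT id; lia.
have {}IH T' : (T < T')%N -> forall i, (i < d)%N -> (i.*2 <= T')%N -> (G i)`_(T' - i.*2) = 0.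
  by move=> TT; apply: IH; lia.
apply: (iter_euler_op_free dN).
apply/polyP => j; rewrite coef0 coef_sum.
have := congr1 (fun p : {poly {poly R}} => p`_j`_T) F0.
rewrite !coef0 coef_sum coef_sum => E; rewrite -[RHS]E big_mkcond.
apply: eq_bigr => -[i id] _ /=; rewrite coef_sum coef_sum.
have cE k : (((G i)`_k *: 'X^(i.*2))%:P * dl k)`_j`_T =
    if (T < i.*2)%N then 0 else (G i)`_k * (dl k)`_j`_(T - i.*2).
  by rewrite coefCM -scalerAl coefZ coefXnM; case: ifP; rewrite ?mulr0.
under [RHS]eq_bigr => k _ do rewrite cE.
case: leqP => iT; last by rewrite big1.
have hk k : k != (T - i.*2)%N -> (G i)`_k * (dl k)`_j`_(T - i.*2) = 0.
  rewrite neq_ltn => /orP[kT|kT].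
    by rewrite ((coef_iter_form_theta R N k).2 j).1// mulr0.
  by rewrite -[k](addnK i.*2) IH ?mul0r//; lia.
rewrite coefZ -((coef_iter_form_theta R N (T - i.*2)).2 j).2.
case: (ltnP (T - i.*2) K) => TK.
  rewrite (bigD1 (Ordinal TK))//= big1 ?addr0// => k kT.
  by apply: hk; exact: kT.
rewrite nth_default; last exact: leq_trans (GK _ id) TK.
by rewrite mul0r big1// => k _; apply: hk; have := ltn_ord k; lia.
Qed.

(** To return from [n!^2 a_n] to [a_n], the squares [(n-i)!^2] are reduced to the common
    [(n-d+1)!^2]: at [n - i] the inserted factor is [((n-i)! / (n-d+1)!)^2], and it is 0 when
    [n < d - 1]. *)
Theorem banana_coef_operator_eq0 (l d : nat) (E : nat -> {poly R}) :
  (d.*2 <= l.+2)%N ->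
  (forall n, \sum_(i < d | (i <= n)%N)
     (E i).[(n - i)%N%:R] * banana_coef R l (n - i) = 0) ->
  forall i, (i < d)%N -> E i = 0.
Proof.
move=> dl Erec i id.
suff : E i * falling (d.-1 - i) ^+ 2 = 0.
  by move=> /eqP; rewrite mulf_eq0 expf_eq0 /= (negPf (falling_neq0 _)) orbF => /eqP.
apply: (@bessel0X_operator_eq0 l.+1 d (fun i => E i * falling (d.-1 - i) ^+ 2)) => // n.
have fE j : (j < d)%N -> (j <= n)%N -> (E j * falling (d.-1 - j) ^+ 2).[(n - j)%N%:R] *
    fps_coef (A ^+ l.+1) (n - j).*2 =
    (if (d.-1 <= n)%N then ((n - d.-1)`!%:R ^- 2) else 0) * ((E j).[(n - j)%N%:R] * banana_coef R l (n - j)).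
  move=> jd jn; rewrite hornerM horner_exp horner_falling banana_coefE.
  case: ifPn => [dn|dn]; last by rewrite ffact_small; [ring|move: dn; lia].
  have := @ffact_fact (n - j) (d.-1 - j); rewrite (_ : (n - j - (d.-1 - j))%N = (n - d.-1)%N); last lia.
  move=> <-; last by lia.
  rewrite natrM; field.
  by rewrite pnatr_eq0 -lt0n fact_gt0.
under eq_bigr => j jn do rewrite fE//.
by rewrite -mulr_sumr Erec mulr0.
Qed.

End Uniqueness.

(** * Calculus of [z d/dz] on an interval [0 < z < r] *)

Section ThetaOn.
Variable R : realType.
Implicit Types (f g : R -> R) (r z : R).

(** A relation rather than an operator, so that [g = theta f] carries the differentiability of [f]
    with it. *)
Definition theta_on r f g := forall z, 0 < z < r -> is_derive z (1 : R) f (g z / z).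

Lemma near_itv0 r z : 0 < z < r -> \forall x \near z, 0 < x < r.
Proof.
move=> /andP[z0 zr]; near=> x; apply/andP; split; near: x.
  exact: lt_nbhsr.
exact: lt_nbhsl.
Unshelve. all: by end_near. Qed.

Lemma eq_theta_on r f f' g g' : theta_on r f g ->
  (forall z, 0 < z < r -> f z = f' z) -> (forall z, 0 < z < r -> g z = g' z) ->
  theta_on r f' g'.
Proof.
move=> fg ff gg z zr; rewrite -gg//; apply: near_eq_is_derive (fg z zr).
by apply: filterS (near_itv0 zr) => x /ff.
Qed.

Lemma theta_on_unique r f g g' : theta_on r f g -> theta_on r f g' ->
  forall z, 0 < z < r -> g z = g' z.
Proof.
move=> fg fg' z zr; have [z0 _] := andP zr.
have [_ e1] := fg z zr; have [_ e2] := fg' z zr.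
by move: e2; rewrite e1 => /(mulIf (lt0r_neq0 _)) -> //; rewrite invr_gt0.
Qed.

Lemma theta_onW r r' f g : r' <= r -> theta_on r f g -> theta_on r' f g.
Proof. by move=> rr fg z /andP[z0 zr]; apply: fg; rewrite z0 (lt_le_trans zr). Qed.

Lemma theta_onD r f f' g g' : theta_on r f g -> theta_on r f' g' ->
  theta_on r (fun z => f z + f' z) (fun z => g z + g' z).
Proof.
move=> fg fg' z zr; rewrite mulrDl.
exact: (is_deriveD (fg z zr) (fg' z zr)).
Qed.

Lemma theta_onM r f f' g g' : theta_on r f g -> theta_on r f' g' ->
  theta_on r (fun z => f z * f' z) (fun z => g z * f' z + f z * g' z).
Proof.
move=> fg fg' z zr; have := is_deriveM (fg z zr) (fg' z zr).
rewrite (_ : f z *: _ + _ = (g z * f' z + f z * g' z) / z)//.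
by rewrite /GRing.scale /=; ring.
Qed.

Lemma theta_on_cst r (c : R) : theta_on r (fun=> c) (fun=> 0).
Proof. by move=> z zr; rewrite mul0r; exact: is_derive_cst. Qed.

Lemma theta_onZ r (c : R) f g : theta_on r f g ->
  theta_on r (fun z => c * f z) (fun z => c * g z).
Proof.
move=> fg; apply: (eq_theta_on (theta_onM (@theta_on_cst r c) fg)) => // z _.
by rewrite mul0r add0r.
Qed.

Lemma theta_on_sum r (I : Type) (s : seq I) (P : pred I) (F G : I -> R -> R) :
  (forall i, P i -> theta_on r (F i) (G i)) ->
  theta_on r (fun z => \sum_(i <- s | P i) F i z) (fun z => \sum_(i <- s | P i) G i z).
Proof.
move=> FG; elim: s => [|i s IH].
  apply: (eq_theta_on (@theta_on_cst r 0)) => z _; by rewrite big_nil.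
case Pi: (P i).
  by apply: (eq_theta_on (theta_onD (FG i Pi) IH)) => z _; rewrite big_cons Pi.
by apply: (eq_theta_on IH) => z _; rewrite big_cons Pi.
Qed.

Lemma theta_on_id r : theta_on r id id.
Proof.
move=> z /andP[z0 _]; rewrite divff ?gt_eqF//; exact: is_derive_id.
Qed.

Lemma theta_onXn r k : theta_on r (fun z => z ^+ k) (fun z => k%:R * z ^+ k).
Proof.
elim: k => [|k IH].
  by apply: (eq_theta_on (@theta_on_cst r 1)) => z _; rewrite ?mul0r.
apply: (eq_theta_on (theta_onM (@theta_on_id r) IH)) => z _; rewrite exprS//.
by rewrite -natr1; ring.
Qed.

Lemma theta_on_ln r : theta_on r (@ln R) (fun=> 1).
Proof. by move=> z /andP[z0 _]; rewrite mul1r; exact: is_derive1_ln. Qed.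

Lemma theta_onX r f g k : theta_on r f g ->
  theta_on r (fun z => f z ^+ k) (fun z => k%:R * f z ^+ k.-1 * g z).
Proof.
move=> fg; elim: k => [|k IH].
  by apply: (eq_theta_on (@theta_on_cst r 1)) => z _; rewrite ?mul0r.
apply: (eq_theta_on (theta_onM fg IH)) => z _; rewrite ?exprS//=.
case: k {IH} => [|k] /=; first by rewrite expr0; ring.
by rewrite -!natr1 exprS; ring.
Qed.

Lemma theta_on0_cst r f : theta_on r f (fun=> 0) ->
  forall x y, 0 < x < r -> 0 < y < r -> f x = f y.
Proof.
move=> f0 x y; wlog xy : x y / x < y.
  move=> H xr yr; case: (ltgtP x y) => [/H -> //|/H -> //|-> //].
move=> /andP[x0 xr] /andP[y0 yr].
have d z : x <= z <= y -> is_derive z (1 : R) f 0.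
  move=> /andP[xz zy]; have := f0 z; rewrite mul0r; apply.
  by rewrite (lt_le_trans x0 xz) (le_lt_trans zy yr).
have [z|z|c _ e] := @MVT_segment R f (fun=> 0) x y (ltW xy).
- by rewrite in_itv => /andP[/ltW xz /ltW zy]; apply: d; rewrite xz.
- by apply: derivable_within_continuous => t /[!in_itv] /d [].
- by move: e; rewrite mul0r => /eqP; rewrite subr_eq0 => /eqP.
Qed.

End ThetaOn.

(** * Passage between [d/dz] and [theta = z d/dz] *)

Section Jets.
Variable R : realType.
Implicit Types (f g : R -> R) (r z : R) (H : nat -> R -> R) (p q : {poly R}).

Definition theta_fun f : R -> R := fun z => z * derive1 f z.

(** [H] lists the functions [theta^i f]; for [size p <= n] this is [p(theta) f]. *)
Definition op_eval H n p z : R := \sum_(i < n) p`_i * H i z.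

Lemma op_evalD H n p q z : op_eval H n (p + q) z = op_eval H n p z + op_eval H n q z.
Proof. by rewrite -big_split /=; apply: eq_bigr => i _; rewrite coefD mulrDl. Qed.

Lemma op_evalZ H n c p z : op_eval H n (c *: p) z = c * op_eval H n p z.
Proof. by rewrite mulr_sumr; apply: eq_bigr => i _; rewrite coefZ mulrA. Qed.

Lemma op_eval_sum H n (I : Type) (s : seq I) (P : pred I) (F : I -> {poly R}) z :
  op_eval H n (\sum_(i <- s | P i) F i) z = \sum_(i <- s | P i) op_eval H n (F i) z.
Proof.
apply: (big_morph (fun p => op_eval H n p z)) => [p q|]; first exact: op_evalD.
by rewrite /op_eval big1 // => i _; rewrite coef0 mul0r.
Qed.

Lemma op_evalXn H n k z : (k < n)%N -> op_eval H n 'X^k z = H k z.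
Proof.
move=> kn; rewrite /op_eval (bigD1 (Ordinal kn))//= coefXn eqxx mul1r big1 ?addr0// => i.
by rewrite coefXn => /negPf ik; rewrite (_ : (i == k :> nat) = false) ?mul0r.
Qed.

Lemma op_eval_wide H n m p z : (size p <= n)%N -> (n <= m)%N ->
  op_eval H n p z = op_eval H m p z.
Proof.
move=> sp nm; rewrite /op_eval -!(big_mkord xpredT (fun i => p`_i * H i z)).
rewrite [RHS](big_cat_nat _ nm)//=.
rewrite [X in _ + X]big_nat_cond [X in _ + X]big1 ?addr0//.
move=> i /andP[/andP[ni _] _]; rewrite nth_default ?mul0r//.
exact: leq_trans ni.
Qed.

Lemma theta_on_op_eval r H l p : (forall i, (i < l)%N -> theta_on r (H i) (H i.+1)) ->
  (size p <= l)%N ->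
  theta_on r (op_eval H l.+1 p) (op_eval H l.+1 ('X * p)).
Proof.
move=> HH sp.
have S i : (i < l)%N -> theta_on r (fun z => p`_i * H i z) (fun z => p`_i * H i.+1 z).
  by move=> il; exact: theta_onZ (HH i il).
have := @theta_on_sum R r 'I_l (index_enum _) xpredT (fun (i : 'I_l) z => p`_i * H i z)
   (fun (i : 'I_l) z => p`_i * H i.+1 z) (fun i _ => S i (ltn_ord i)).
move/eq_theta_on; apply=> z _.
  by rewrite /op_eval big_ord_recr /= [p`_l]nth_default// mul0r addr0.
rewrite /op_eval big_ord_recl coefXM mul0r add0r; apply: eq_bigr => i _.
by rewrite coefXM.
Qed.

Definition shifted_falling k : {poly R} := \prod_(i < k) ('X + (1 - i%:R)%:P).

Lemma shifted_fallingS k :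
  shifted_falling k.+1 = ('X + (1 - k%:R)%:P) * shifted_falling k.
Proof. by rewrite /shifted_falling big_ord_recr mulrC. Qed.

Lemma shifted_falling_monic k : shifted_falling k \is monic.
Proof. by apply: monic_prod => i _; exact: monicXaddC. Qed.

Lemma size_shifted_falling k : size (shifted_falling k) = k.+1.
Proof.
elim: k => [|k IH]; first by rewrite /shifted_falling big_ord0 size_poly1.
rewrite shifted_fallingS size_monicM ?monicXaddC ?monic_neq0 ?shifted_falling_monic//.
by rewrite size_XaddC IH.
Qed.

Lemma shifted_falling_lead k : (shifted_falling k)`_k = 1.
Proof.
have /monicP := shifted_falling_monic k.
by rewrite lead_coefE size_shifted_falling.
Qed.

Lemma theta_on_theta_fun r f g : theta_on r f g -> theta_on r f (theta_fun f).
Proof.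
move=> fg z zr; have := fg z zr; rewrite /theta_fun => D.
have z0 : z != 0 by rewrite gt_eqF//; case/andP: zr.
have E : derive1 f z = g z / z by rewrite derive1E; case: D => _ ->.
by rewrite mulrC mulKf// E.
Qed.

Lemma theta_fun_eq r f g : theta_on r f g ->
  forall z, 0 < z < r -> theta_fun f z = g z.
Proof. by move=> fg z; exact: theta_on_unique (theta_on_theta_fun fg) fg z. Qed.

Lemma iter_theta_fun_eq r f H l : (forall z, 0 < z < r -> f z = H 0 z) ->
  (forall i, (i < l)%N -> theta_on r (H i) (H i.+1)) ->
  forall i, (i <= l)%N -> forall z, 0 < z < r -> iter i theta_fun f z = H i z.
Proof.
move=> fH HH; elim=> [|i IH] il z zr; first exact: fH.
rewrite iterS; apply: (theta_fun_eq (r := r)) => //.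
by apply: (eq_theta_on (HH i il)) => // x xr; rewrite -IH// ltnW.
Qed.

(* [z^k f^(k) = theta (theta - 1) ... (theta - k + 1) f], conjugated by the
   factor [z] in [f = z (f / z)]. *)
Lemma derive1n_theta r l f :
  (forall z, 0 < z < r -> forall k, (k < l)%N -> derivable (derive1n k f) z 1) ->
  let H i := iter i theta_fun (fun z => f z / z) in
  (forall i, (i < l)%N -> theta_on r (H i) (H i.+1)) /\
  forall k, (k <= l)%N -> forall z, 0 < z < r ->
    z ^+ k * derive1n k f z = z * op_eval H l.+1 (shifted_falling k) z.
Proof.
move=> fd H.
have fD k : (k < l)%N -> theta_on r (derive1n k f) (fun z => z * derive1n k.+1 f z).
  move=> kl z zr; rewrite mulrC mulKf; last by rewrite gt_eqF//; case/andP: zr.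
  by rewrite derive1nS derive1E; apply: DeriveDef => //; exact: fd.
suff K k : (k <= l)%N -> (forall i, (i < k)%N -> theta_on r (H i) (H i.+1)) /\
   forall z, 0 < z < r ->
     z ^+ k * derive1n k f z = z * op_eval H l.+1 (shifted_falling k) z.
  split; first exact: (K l (leqnn l)).1.
  by move=> k kl; exact: (K k kl).2.
elim: k => [|k IH] kl.
  split=> // z /andP[z0 _]; rewrite /shifted_falling big_ord0.
  have := @op_evalXn H l.+1 0 z isT; rewrite expr0 => ->.
  by rewrite mul1r /H /= mulrC divfK// gt_eqF.
have [HH E] := IH (ltnW kl).
(* Differentiability is given for [f^(k)], not for [H k]. Since [shifted_falling k] is monic, [H k]
   is [z^(k-1) f^(k)] minus a combination [q] of lower jets, which are already known to be
   differentiable. *)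
pose q := shifted_falling k - 'X^k.
have sq : (size q <= k)%N.
  apply/leq_sizeP => j; rewrite leq_eqVlt => /orP[/eqP <-|kj].
    by rewrite coefB coefXn eqxx shifted_falling_lead subrr.
  rewrite coefB coefXn gtn_eqF// subr0 nth_default//.
  by rewrite size_shifted_falling.
have Hk z : 0 < z < r -> z ^+ k * derive1n k f z * z ^-1 - op_eval H k.+1 q z = H k z.
  move=> zr; rewrite E//; have z0 : z != 0 by rewrite gt_eqF//; case/andP: zr.
  rewrite mulrAC divff// mul1r.
  rewrite (@op_eval_wide H k.+1 l.+1) ?(leq_trans sq) ?ltnS ?(ltnW kl)//.
  rewrite -[op_eval H l.+1 q z]mul1r -mulNr -op_evalZ -op_evalD /q scaleN1r.
  by rewrite opprB addrC subrK op_evalXn// ltnS ltnW.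
have zV : theta_on r (fun z : R => z^-1) (fun z => - z^-1).
  move=> z zr; have z0 : z != 0 by rewrite gt_eqF//; case/andP: zr.
  have := is_deriveV z0 (is_derive_id z (1 : R)).
  rewrite (_ : - _ *: _ = - z^-1 / z) // /GRing.scale /= mulr1.
  by rewrite expr2 invfM mulNr.
have HkD : theta_on r (H k) (H k.+1).
  have D1 := theta_onM (theta_onM (@theta_onXn R r k) (fD k kl)) zV.
  have D2 := theta_onZ (-1) (theta_on_op_eval HH sq).
  apply: (theta_on_theta_fun (eq_theta_on (theta_onD D1 D2) _ _)) => z zr.
    by rewrite mulN1r Hk.
  by [].
have HH' i : (i < k.+1)%N -> theta_on r (H i) (H i.+1).
  by rewrite ltnS leq_eqVlt => /orP[/eqP -> //|]; exact: HH.
split=> // z zr; have z0 : z != 0 by rewrite gt_eqF//; case/andP: zr.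
have D1 := theta_onM (@theta_onXn R r k) (fD k kl).
have D2 : theta_on r (fun x => x ^+ k * derive1n k f x)
    (fun x => x * op_eval H l.+1 (shifted_falling k) x
              + x * op_eval H l.+1 ('X * shifted_falling k) x).
  have sk : (size (shifted_falling k) <= k.+1)%N by rewrite size_shifted_falling.
  have := theta_onM (@theta_on_id R r) (theta_on_op_eval HH' sk).
  move/eq_theta_on; apply=> x xr /=.
    by rewrite E// (@op_eval_wide H k.+2 l.+1)// (leq_trans sk).
  rewrite !(@op_eval_wide H k.+2 l.+1)// ?(leq_trans sk)//.
  rewrite size_monicM ?monicX ?monic_neq0 ?shifted_falling_monic//.
  by rewrite size_polyX size_shifted_falling.
have /esym := theta_on_unique D1 D2 zr.
rewrite shifted_fallingS mulrDl op_evalD mul_polyC op_evalZ mulrDr => E1.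
have E0 := E z zr.
have E2 := congr1 (fun x => k%:R * x) E0; rewrite /= in E2.
rewrite exprS; lra.
Qed.

End Jets.

(** * Power series *)

Section PowerSeries.
Variable R : realType.
Implicit Types (c : nat -> R) (e z s : R).

Definition ps_conv c e := forall z, `|z| < e -> cvgn (pseries c z).

Definition ps_sum c z : R := limn (pseries c z).

Lemma ps_sumP c e z : ps_conv c e -> `|z| < e -> pseries c z @ \oo --> ps_sum c z.
Proof. by move=> cv ze; have := cv z ze. Qed.

Lemma ps_sum_eq c z s : pseries c z @ \oo --> s -> ps_sum c z = s.
Proof. by move=> H; apply: cvg_lim. Qed.

Lemma pseriesS c z n : pseries c z n.+1 = pseries c z n + c n * z ^+ n.
Proof. by rewrite /pseries /series /= big_nat_recr. Qed.

Lemma pseries0n c z : pseries c z 0 = 0.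
Proof. by rewrite /pseries /series /= big_geq. Qed.

Lemma cvg_pseriesD c1 c2 z s1 s2 : pseries c1 z @ \oo --> s1 -> pseries c2 z @ \oo --> s2 ->
  pseries (fun n => c1 n + c2 n) z @ \oo --> s1 + s2.
Proof.
move=> h1 h2; rewrite (_ : pseries _ _ = pseries c1 z \+ pseries c2 z); first exact: cvgD.
apply/funext => n; rewrite /pseries /series /= -[RHS]big_split /=.
by apply: eq_bigr => i _; rewrite mulrDl.
Qed.

Lemma cvg_pseriesZ a c z s : pseries c z @ \oo --> s ->
  pseries (fun n => a * c n) z @ \oo --> a * s.
Proof.
move=> h; rewrite (_ : pseries _ _ = fun n => a * pseries c z n); first exact: cvgMl_tmp.
apply/funext => n; rewrite /pseries /series /= mulr_sumr.
by apply: eq_bigr => i _; rewrite mulrA.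
Qed.

Lemma cvg_pseries0 z : pseries (fun=> 0) z @ \oo --> (0 : R).
Proof.
rewrite (_ : pseries _ _ = fun=> 0); first exact: cvg_cst.
by apply/funext => n; rewrite /pseries /series /= big1// => i _; rewrite mul0r.
Qed.

Lemma cvg_pseries_sum (I : Type) (r : seq I) (P : pred I) (C : I -> nat -> R) (T : I -> R) z :
  (forall i, P i -> pseries (C i) z @ \oo --> T i) ->
  pseries (fun n => \sum_(i <- r | P i) C i n) z @ \oo --> \sum_(i <- r | P i) T i.
Proof.
move=> CT; elim: r => [|i r IH].
  rewrite big_nil (_ : (fun n => _) = fun=> 0); first exact: cvg_pseries0.
  by apply/funext => n; rewrite big_nil.
rewrite big_cons (_ : (fun n => _) = fun n => if P i then C i n + \sum_(j <- r | P j) C j n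
   else \sum_(j <- r | P j) C j n); last by apply/funext => n; rewrite big_cons.
by case: ifP => // Pi; apply: cvg_pseriesD => //; exact: CT.
Qed.

Lemma cvg_pseries_shift c z s k : pseries c z @ \oo --> s ->
  pseries (fun n => if (k <= n)%N then c (n - k)%N else 0) z @ \oo --> z ^+ k * s.
Proof.
move=> h; rewrite -(cvg_shiftn k) (_ : (fun n => _) = fun n => z ^+ k * pseries c z n).
  exact: cvgMl_tmp.
apply/funext; elim=> [|n IH] /=.
  rewrite pseries0n mulr0 add0n /pseries /series /= big_nat_cond big1// => i /andP[/andP[_ ik] _].
  by rewrite leqNgt ik /= mul0r.
by rewrite addSn !pseriesS mulrDr IH leq_addl addnK exprD; ring.
Qed.

Lemma cvg_pseries_behead c z s : z != 0 -> pseries c z @ \oo --> s ->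
  pseries (fun n => c n.+1) z @ \oo --> (s - c 0%N) / z.
Proof.
move=> z0; rewrite -cvg_shiftS => h.
rewrite (_ : pseries _ _ = fun n => z^-1 * (pseries c z n.+1 - c 0%N)).
  by rewrite mulrC; apply: cvgMl_tmp; apply: cvgB => //; exact: cvg_cst.
apply/funext; elim=> [|n IH].
  by rewrite pseriesS !pseries0n expr0 mulr1 add0r subrr mulr0.
rewrite pseriesS IH [pseries c z n.+2]pseriesS exprS; field.
by [].
Qed.

Lemma ps_sumD c1 c2 e z : ps_conv c1 e -> ps_conv c2 e -> `|z| < e ->
  ps_sum (fun n => c1 n + c2 n) z = ps_sum c1 z + ps_sum c2 z.
Proof.
by move=> h1 h2 ze; apply/ps_sum_eq/cvg_pseriesD; apply: ps_sumP ze.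
Qed.

Lemma ps_convD c1 c2 e : ps_conv c1 e -> ps_conv c2 e -> ps_conv (fun n => c1 n + c2 n) e.
Proof.
move=> h1 h2 z ze; apply/cvg_ex; eexists.
by apply: cvg_pseriesD; apply: ps_sumP ze.
Qed.

Lemma ps_conv0 e : ps_conv (fun=> 0) e.
Proof. by move=> z _; apply/cvg_ex; exists 0; exact: cvg_pseries0. Qed.

Lemma ps_conv_behead c e : 0 < e -> ps_conv c e -> ps_conv (fun n => c n.+1) e.
Proof.
move=> e0 h z ze; case: (eqVneq z 0) => [->|z0].
  apply: (@is_cvg_pseries_inside _ _ (e / 2)); last first.
    by rewrite normr0 gtr0_norm ?divr_gt0.
  apply/cvg_ex; eexists; apply: cvg_pseries_behead; first by rewrite gt_eqF ?divr_gt0.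
  by apply: (ps_sumP h); rewrite gtr0_norm ?divr_gt0//; lra.
by apply/cvg_ex; eexists; apply: cvg_pseries_behead => //; exact: ps_sumP ze.
Qed.

Lemma ps_sum_behead c e z : ps_conv c e -> `|z| < e -> z != 0 ->
  ps_sum c z = c 0%N + z * ps_sum (fun n => c n.+1) z.
Proof.
move=> h ze z0.
rewrite (ps_sum_eq (cvg_pseries_behead z0 (ps_sumP h ze))); field.
by [].
Qed.

(* The factor [n+1] is absorbed by
   [(n+1) (K - |z|) |z|^n <= K^(n+1) - |z|^(n+1)], for [|z| < K < e]. *)
Lemma ps_conv_diffs c e : ps_conv c e -> ps_conv (pseries_diffs c) e.
Proof.
move=> h z ze.
pose K := (`|z| + e) / 2; have zK : `|z| < K by rewrite /K; lra.
have Ke : K < e by rewrite /K; lra.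
have K0 : 0 < K := le_lt_trans (normr_ge0 z) zK.
pose K' := (K + e) / 2; have KK' : K < K' by rewrite /K'; lra.
have K'0 := lt_trans K0 KK'; have K'e : K' < e by rewrite /K'; lra.
have cK : cvgn (pseries (fun i => `|c i|) K).
  apply: (@is_cvg_pseries_inside_norm _ _ K'); last by rewrite !gtr0_norm.
  by apply: h; rewrite gtr0_norm.
have b n : n.+1%:R * `|z| ^+ n <= (K / (K - `|z|)) * K ^+ n.
  have d0 : 0 < K - `|z| by rewrite subr_gt0.
  have : n.+1%:R * (K - `|z|) * `|z| ^+ n <= K ^+ n.+1.
    have -> : K ^+ n.+1 = (K ^+ n.+1 - `|z| ^+ n.+1) + `|z| ^+ n.+1 by rewrite subrK.
    rewrite subrXX -[leLHS]addr0; apply: lerD; last by rewrite exprn_ge0.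
    rewrite [_ * (K - _)]mulrC -mulrA ler_wpM2l ?(ltW d0)//.
    rewrite mulr_natl -[n.+1 in leLHS]card_ord -sumr_const ler_sum// => i _.
    rewrite /= -[leLHS](_ : `|z| ^+ (n - i) * `|z| ^+ i = _); last first.
      by rewrite -exprD subnK// -ltnS.
    by rewrite ler_wpM2r ?exprn_ge0// lerXn2r ?nnegrE ?(ltW zK) ?(ltW K0) ?normr_ge0.
  rewrite mulrAC -ler_pdivlMr// exprS => H; apply: le_trans H _.
  by rewrite mulrAC.
apply: normed_cvg; rewrite /normed_series_of /=.
apply: (@series_le_cvg _ _ (fun n => (K - `|z|)^-1 * (`|c n.+1| * K ^+ n.+1))).
- by move=> n; exact: normr_ge0.
- move=> n; rewrite mulr_ge0 ?invr_ge0 ?subr_ge0 ?(ltW zK)// mulr_ge0//.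
  by rewrite exprn_ge0// ltW.
- move=> n; rewrite /pseries_diffs !normrM normr_nat normrX.
  have := ler_wpM2l (normr_ge0 (c n.+1)) (b n); rewrite exprS => H.
  by rewrite mulrAC [_ * `|c _|]mulrC (le_trans H)// le_eqVlt; apply/orP; left; apply/eqP; field;
     rewrite gt_eqF ?subr_gt0.
apply: (@is_cvg_seriesZ _ (fun n => `|c n.+1| * K ^+ n.+1)).
have : cvgn (fun n => pseries (fun i => `|c i|) K n.+1 - `|c 0%N|).
  apply: is_cvgB; last exact: is_cvg_cst.
  by apply/cvg_ex; eexists; rewrite cvg_shiftS; exact: cK.
rewrite (_ : (fun n => _) = series (fun n => `|c n.+1| * K ^+ n.+1))//.
apply/funext => n; rewrite /pseries /series /= big_nat_recl// expr0 mulr1.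
by rewrite addrC addKr.
Qed.

Lemma is_derive_ps_sum c e z : ps_conv c e -> `|z| < e ->
  is_derive z (1 : R) (ps_sum c) (ps_sum (pseries_diffs c) z).
Proof.
move=> h ze; pose K := (`|z| + e) / 2; have zK : `|z| < K by rewrite /K; lra.
have K0 : 0 < K := le_lt_trans (normr_ge0 z) zK.
have Ke : `|K| < e by rewrite gtr0_norm// /K; lra.
have h1 := ps_conv_diffs h.
apply: (@pseries_snd_diffs _ _ K); [exact: h|exact: h1| |by rewrite (gtr0_norm K0)].
exact: (ps_conv_diffs h1).
Qed.

Lemma theta_on_ps_sum c e : 0 < e -> ps_conv c e ->
  theta_on e (ps_sum c) (ps_sum (fun n => n%:R * c n)) /\
  ps_conv (fun n => n%:R * c n) e.
Proof.
move=> e0 h; have h1 := ps_conv_diffs h.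
have E z : `|z| < e -> pseries (fun n => n%:R * c n) z @ \oo -->
    z * ps_sum (pseries_diffs c) z.
  move=> ze; have := cvg_pseries_shift (k := 1%N) (ps_sumP h1 ze); rewrite expr1.
  rewrite (_ : (fun n => _) = (fun n => n%:R * c n))//.
  by apply/funext => -[|n] /=; rewrite ?mul0r// /pseries_diffs subn1.
split=> [z /andP[z0 ze]|z ze]; last by apply/cvg_ex; eexists; exact: E ze.
have ze' : `|z| < e by rewrite gtr0_norm.
rewrite (ps_sum_eq (E z ze')) mulrC mulKf ?gt_eqF//.
exact: is_derive_ps_sum h ze'.
Qed.

Lemma cvg_ps_sum0 c e : 0 < e -> ps_conv c e -> ps_sum c z @[z --> 0^'+] --> c 0%N.
Proof.
move=> e0 h; have D : is_derive (0 : R) (1 : R) (ps_sum c) (ps_sum (pseries_diffs c) 0).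
  by apply: is_derive_ps_sum h _; rewrite normr0.
have C : {for (0 : R), continuous (ps_sum c)}.
  by apply/differentiable_continuous/derivable1_diffP; case: D.
have <- : ps_sum c 0 = c 0%N.
  apply: ps_sum_eq; rewrite -cvg_shiftS (_ : (fun n => _) = fun=> c 0%N); first exact: cvg_cst.
  apply/funext; elim=> [|n IH]; rewrite pseriesS.
    by rewrite pseries0n expr0 mulr1 add0r.
  by rewrite IH exprS mul0r mulr0 addr0.
exact: cvg_at_right_filter.
Qed.

(** Vanishing is assumed only to the right of 0, so the constant term is obtained as a right limit,
    and the others by dividing by [z]. *)
Lemma ps_sum_eq0 c e : 0 < e -> ps_conv c e -> (forall z, 0 < z < e -> ps_sum c z = 0) ->
  forall n, c n = 0.
Proof.
move=> e0 h c0 n.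
have base c' : ps_conv c' e -> (forall z, 0 < z < e -> ps_sum c' z = 0) -> c' 0%N = 0.
  move=> h' c0'; have L0 : ps_sum c' z @[z --> 0^'+] --> (0 : R).
    apply: cvg_near_cst; near=> z; apply: c0'; apply/andP; split; near: z.
      exact: nbhs_right_gt.
    exact: nbhs_right_lt.
  exact: (cvg_unique _ (cvg_ps_sum0 e0 h') L0).
elim: n c h c0 => [|n IH] c h c0; first exact: base.
apply: (IH (fun n => c n.+1)); first exact: ps_conv_behead.
move=> z zr; have [z0 ze] := andP zr.
have ze' : `|z| < e by rewrite gtr0_norm.
apply/ps_sum_eq; have := cvg_pseries_behead (lt0r_neq0 z0) (ps_sumP h ze').
by rewrite c0// base// subrr mul0r.
Unshelve. all: by end_near. Qed.

End PowerSeries.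

(** * Identification of the Picard-Fuchs operator *)

Section DeltaFacts.
Variable l : nat.
Hypothesis l_gt0 : (0 < l)%N.

Lemma size_Delta : size (Delta l) = (uphalf l.-1).+1.
Proof. by rewrite size_map size_iota. Qed.

(** Together the bounds say that the size is [l/2 + 1] rounded down. The first one allows the
    uniqueness theorem to be applied, the second makes [bop l j] vanish beyond the degree of the
    given operator. *)
Lemma size_Delta_bound : ((size (Delta l)).*2 <= l.+2)%N /\ (l.+2 < (size (Delta l)).+1.*2)%N.
Proof.
rewrite size_Delta; case: l l_gt0 => // n _ /=.
by have := odd_double_half n; rewrite uphalf_half; case: (odd n); lia.
Qed.

Lemma Delta_gt0 m : m \in Delta l -> (0 < m)%N.
Proof.
move=> /mapP[j]; rewrite mem_iota add0n ltnS => /andP[_ jl] ->.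
rewrite expn_gt0 subn_gt0 orbF; have [H _] := size_Delta_bound.
by move: H; rewrite size_Delta; lia.
Qed.

Lemma Delta_le m : m \in Delta l -> (m <= l.+1 ^ 2)%N.
Proof. by move=> /mapP[j _ ->]; rewrite leq_exp2r// leq_subr. Qed.

End DeltaFacts.

Section BananaOperator.
Variables (R : realType) (l : nat) (B : nat -> {poly R}).
Hypotheses (l_gt0 : (0 < l)%N) (hB : banana_PF l B).

Local Notation d := (size (Delta l)).

Definition pf_discr : {poly R} := \prod_(m <- Delta l) (1 - (m%:R)%:P * 'X).

Lemma size_pf_discr : size pf_discr = d.+1.
Proof.
rewrite /pf_discr; move: (@Delta_gt0 _ l_gt0); elim: (Delta l) => [|m s IH] pos.
  by rewrite big_nil size_poly1.
have m0 : - m%:R != 0 :> R.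
  by rewrite oppr_eq0 pnatr_eq0 -lt0n pos// mem_head.
have sm : size (1 - m%:R%:P * 'X : {poly R}) = 2%N.
  by rewrite addrC -mulNr -polyCN -polyC1 size_MXaddC polyC_eq0 (negPf m0) /= size_polyC m0.
rewrite big_cons size_mul -?size_poly_gt0 ?sm ?IH//.
- by move=> x xs; apply: pos; rewrite in_cons xs orbT.
- by move=> x xs; apply: pos; rewrite in_cons xs orbT.
Qed.

Lemma pf_discr0 : pf_discr.[0] = 1.
Proof.
by rewrite horner_prod big1_seq// => m _; rewrite !hornerE ?mulr0 ?subr0 ?oppr0 ?addr0.
Qed.

Lemma pf_discr_neq0 : pf_discr != 0.
Proof. by rewrite -size_poly_gt0 size_pf_discr. Qed.

Lemma B_lead : B l = (-1) ^+ l *: ('X^l * pf_discr).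
Proof.
rewrite (banana_lead hB) -/pf_discr [in LHS]exprNn -[in LHS]signr_odd mulr_sign.
by rewrite -[in RHS]signr_odd scaler_sign; case: odd; rewrite ?mulNr.
Qed.

Lemma size_B_lead : size (B l) = (l + d).+1.
Proof.
rewrite B_lead size_scale ?signr_eq0// size_monicM ?monicXn ?pf_discr_neq0//.
by rewrite size_polyXn size_pf_discr addSn addnS.
Qed.

Lemma mup_B_lead : mup 0 (B l) = l.
Proof.
rewrite B_lead -mul_polyC mupMr; last by rewrite /root hornerC signr_eq0.
rewrite mulrC mupMr; last by rewrite /root pf_discr0 oner_eq0.
by rewrite -['X]subr0 -polyC0 mup_XsubCX eqxx.
Qed.

(** The division is exact by Fuchs' criterion at 0, a root of [B l] of multiplicity exactly [l]. *)
Definition pf_cofactor k : {poly R} := B k %/ 'X^k.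

Lemma B_cofactor k : (k <= l)%N -> B k = 'X^k * pf_cofactor k.
Proof.
move=> kl; rewrite mulrC divpK//.
have [/(_ 0 k kl)] := banana_fuchsian hB.
rewrite mup_B_lead subr0 -{1}(subnKC kl) exprD dvdp_mul2r//.
by rewrite -size_poly_gt0 size_polyXn.
Qed.

(** This is Fuchs' criterion at infinity; it limits the operator to the powers [z^0, ..., z^d]. *)
Lemma size_pf_cofactor k : (k <= l)%N -> (size (pf_cofactor k) <= d.+1)%N.
Proof.
move=> kl; case: (eqVneq (pf_cofactor k) 0) => [->|b0]; first by rewrite size_poly0.
have Bk0 : B k != 0 by rewrite B_cofactor// mulf_neq0// -size_poly_gt0 size_polyXn.
have [_ /(_ k kl Bk0)] := banana_fuchsian hB.
rewrite size_B_lead B_cofactor// size_monicM ?monicXn// size_polyXn.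
move: (size (pf_cofactor k)) => s; lia.
Qed.

Lemma pf_cofactor_lead : pf_cofactor l = (-1) ^+ l *: pf_discr.
Proof.
apply: (mulfI (x := 'X^l)); first by rewrite -size_poly_gt0 size_polyXn.
by rewrite -B_cofactor// B_lead scalerAr.
Qed.

(* [sum_k B_k f^(k) = z sum_j z^j (theta_coef j)(theta) (f / z)]. *)
Definition theta_coef j : {poly R} := \sum_(k < l.+1) (pf_cofactor k)`_j *: shifted_falling R k.

Lemma size_theta_coef j : (size (theta_coef j) <= l.+1)%N.
Proof.
rewrite (leq_trans (size_sum _ _ _))//; apply/bigmax_leqP => k _.
by rewrite (leq_trans (size_scale_leq _ _))// size_shifted_falling.
Qed.

Lemma theta_coef_lead j : (theta_coef j)`_l = (pf_cofactor l)`_j.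
Proof.
rewrite coef_sum big_ord_recr /= coefZ shifted_falling_lead mulr1 big1 ?add0r// => k _.
by rewrite coefZ [(shifted_falling _ _)`_l]nth_default ?mulr0// size_shifted_falling.
Qed.

(** Passing from [f] to [f / z] shifts the indicial polynomial by one, so that [(x-1)^l] becomes
    [x^l]. *)
Lemma theta_coef0 : theta_coef 0 = (-1) ^+ l *: 'X^l.
Proof.
have := congr1 (comp_poly ('X + 1)) (banana_exponents hB).
rewrite /indicial0 linear_sum /= => E.
transitivity (\sum_(i < l.+1) (((B i)`_i *: \prod_(i0 < i) ('X - i0%:R%:P)) \Po ('X + 1))).
  apply: eq_bigr => k _; rewrite comp_polyZ rmorph_prod; congr (_ *: _).
    by rewrite B_cofactor ?leq_ord// coefXnM ltnn subnn.
  apply: eq_bigr => i _; rewrite /= comp_polyB comp_polyX comp_polyC.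
  by rewrite polyCB polyC1 addrA.
rewrite E comp_polyZ rmorphXn /= comp_polyB comp_polyX -polyC1 comp_polyC addrK; congr (_ *: _).
by rewrite B_lead coefZ coefXnM ltnn subnn -horner_coef0 pf_discr0 mulr1.
Qed.

Lemma solves_op_eval r f : solves l B r f ->
  let H i := iter i (@theta_fun R) (fun z => f z / z) in
  (forall i, (i < l)%N -> theta_on r (H i) (H i.+1)) /\
  forall z, 0 < z < r -> \sum_(j < d.+1) z ^+ j * op_eval H l.+1 (theta_coef j) z = 0.
Proof.
move=> sf H.
have [HH E] := @derive1n_theta R r l f (fun z zr => (sf z zr).1).
split=> // z zr; have [_] := sf z zr; have z0 : z != 0 by rewrite gt_eqF//; case/andP: zr.
move=> S; apply: (mulfI z0); rewrite mulr0 -[RHS]S.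
under eq_bigr => j _ do rewrite op_eval_sum mulr_sumr.
rewrite exchange_big mulr_sumr /=; apply: eq_bigr => k _.
rewrite B_cofactor ?leq_ord// hornerM hornerXn mulrAC E ?leq_ord// -mulrA; congr (_ * _).
rewrite (horner_coef_wide _ (size_pf_cofactor (leq_ord k))) mulr_sumr.
by apply: eq_bigr => j _; rewrite op_evalZ; ring.
Qed.

End BananaOperator.

(** * Growth and convergence of the holomorphic solution *)

Section BananaSeries.
Variable R : realType.

Lemma sumr_sqr_le (I : Type) (r : seq I) (F : I -> R) : (forall i, 0 <= F i) ->
  \sum_(i <- r) F i ^+ 2 <= (\sum_(i <- r) F i) ^+ 2.
Proof.
move=> F0; elim: r => [|i r IH]; first by rewrite !big_nil expr0n.
rewrite !big_cons sqrrD; have S0 : 0 <= \sum_(j <- r) F j by apply: sumr_ge0.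
have := mulr_ge0 (F0 i) S0; move: IH; rewrite mulr2n; lra.
Qed.

(** After multiplication by [n!^2], sums of squares of multinomial coefficients are bounded by the
    square of their sum [k^n]. This yields convergence up to [1/(l+1)^2]. *)
Lemma coef_expbessel_le M k n :
  0 <= ((\poly_(i < M) (i`!%:R ^- 2) : {poly R}) ^+ k)`_n <= k%:R ^+ n.*2 / n`!%:R ^+ 2.
Proof.
have f0 i : 0 < i`!%:R :> R by rewrite ltr0n fact_gt0.
elim: k n => [|k IH] n.
  rewrite expr0 coef1; case: n => [|n]; first by rewrite expr0 fact0 expr1n divr1 ler01 lexx.
  by rewrite lexx divr_ge0 // exprn_ge0.
pose Y : {poly R} := \poly_(i < M) (i`!%:R ^- 2).
have Y0 i : 0 <= Y`_i <= i`!%:R ^- 2.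
  have : 0 <= (i`!%:R ^- 2 : R) by rewrite invr_ge0 exprn_ge0// ltW.
  by rewrite coef_poly; case: ifP => _ ->; rewrite lexx.
rewrite exprS coefM; apply/andP; split.
  apply: sumr_ge0 => i _; rewrite mulr_ge0//; first by have /andP[] := Y0 i.
  by have /andP[] := IH (n - i)%N.
apply: (@le_trans _ _ (\sum_(i < n.+1) (k%:R ^+ (n - i) * ('C(n, i))%:R) ^+ 2 / n`!%:R ^+ 2)).
  apply: ler_sum => i _; have /andP[a1 a2] := Y0 i; have /andP[b1 b2] := IH (n - i)%N.
  apply: le_trans (ler_pM a1 b1 a2 b2) _; rewrite le_eqVlt; apply/orP; left; apply/eqP.
  have ni : (i <= n)%N by rewrite -ltnS.
  rewrite -(bin_fact ni) !natrM -muln2 exprM.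
  have := f0 i; have := f0 (n - i)%N => /lt0r_neq0 h1 /lt0r_neq0 h2; field.
  by rewrite h1 h2 pnatr_eq0 -lt0n bin_gt0 ni.
rewrite -mulr_suml ler_pM2r ?invr_gt0 ?exprn_gt0//.
apply: le_trans (sumr_sqr_le _ _) _.
  by move=> i; rewrite mulr_ge0// exprn_ge0.
have S0 : 0 <= \sum_(i < n.+1) k%:R ^+ (n - i) * ('C(n, i))%:R :> R.
  by apply: sumr_ge0 => i _; rewrite mulr_ge0// exprn_ge0.
rewrite -muln2 exprM lerXn2r ?nnegrE ?exprn_ge0//.
rewrite -natr1 exprDn le_eqVlt; apply/orP; left; apply/eqP; apply: eq_bigr => i _.
by rewrite expr1n mulr1 mulr_natr.
Qed.

Lemma banana_coef_le l n : 0 <= banana_coef R l n <= (l.+1%:R ^+ 2) ^+ n.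
Proof.
rewrite banana_coefE coef_bessel0X -exprM mul2n.
have f0 : 0 < n`!%:R ^+ 2 :> R by rewrite exprn_gt0// ltr0n fact_gt0.
have /andP[h1 h2] := coef_expbessel_le n.+1 l.+1 n.
by rewrite mulr_ge0 ?(ltW f0)//= mulrC -ler_pdivlMr.
Qed.

Lemma radius_gt0 l : 0 < Defs.radius R l.
Proof. by rewrite invr_gt0 exprn_gt0. Qed.

Lemma ps_conv_banana l : ps_conv (banana_coef R l) (Defs.radius R l).
Proof.
move=> z zr; apply: normed_cvg; rewrite /normed_series_of /=.
apply: (@series_le_cvg _ _ (fun n => geometric 1 (l.+1%:R ^+ 2 * `|z|) n)) => [n|n|n|].
- exact: normr_ge0.
- by rewrite /= mul1r exprn_ge0// mulr_ge0.
- rewrite /= mul1r normrM normrX exprMn; have /andP[h0 h1] := banana_coef_le l n.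
  by rewrite ger0_norm// ler_wpM2r// exprn_ge0.
apply: is_cvg_geometric_series; rewrite ger0_norm ?mulr_ge0//.
by move: zr; rewrite /Defs.radius -[X in _ < X]mul1r ltr_pdivlMr ?exprn_gt0// mulrC.
Qed.

Lemma banana_holoE l z : `|z| < Defs.radius R l ->
  banana_holo l z = z * ps_sum (banana_coef R l) z.
Proof.
move=> zr; apply: cvg_lim => //.
rewrite (_ : series _ = fun n => z * pseries (banana_coef R l) z n).
  by apply: cvgMl_tmp; apply: (ps_sumP (@ps_conv_banana l) zr).
apply/funext => n; rewrite /pseries /series /= mulr_sumr; apply: eq_bigr => i _.
by rewrite exprS; ring.
Qed.

End BananaSeries.

Section Identification.
Variables (R : realType) (l : nat) (B : nat -> {poly R}).
Hypotheses (l_gt0 : (0 < l)%N) (hB : banana_PF l B).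
Local Notation d := (size (Delta l)).
Local Notation Q := (theta_coef l B).
Local Notation c := (banana_coef R l).

(** The equation is given between functions on [0 < z < r]. There the jets of the holomorphic
    solution are the power series [K i], so the left side is a power series with sum 0 and its
    coefficients vanish. *)
Lemma theta_coef_annihilates n :
  \sum_(j < d.+1 | (j <= n)%N) (Q j).[(n - j)%N%:R] * c (n - j) = 0.
Proof.
have r0 := radius_gt0 R l.
pose K i := ps_sum (fun n => n%:R ^+ i * c n).
have cvK i : ps_conv (fun n => n%:R ^+ i * c n) (Defs.radius R l).
  elim: i => [|i IH].
    rewrite (_ : (fun n => _) = c); first exact: ps_conv_banana.
    by apply/funext => m; rewrite mul1r.
  rewrite (_ : (fun n => _) = (fun n => n%:R * (n%:R ^+ i * c n))).
    by have [] := theta_on_ps_sum r0 IH.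
  by apply/funext => m; rewrite exprS mulrA.
have thK i : theta_on (Defs.radius R l) (K i) (K i.+1).
  have [H _] := theta_on_ps_sum r0 (cvK i).
  rewrite /K (_ : (fun n => n%:R ^+ i.+1 * c n) = (fun n => n%:R * (n%:R ^+ i * c n)))//.
  by apply/funext => m; rewrite exprS mulrA.
have [HH E] := solves_op_eval l_gt0 hB (banana_annihilates hB).
have HK i : (i <= l)%N -> forall z, 0 < z < Defs.radius R l ->
    iter i (@theta_fun R) (fun z => banana_holo l z / z) z = K i z.
  apply: iter_theta_fun_eq => [z /andP[z0 zr]|j _]; last exact: thK.
  rewrite banana_holoE ?gtr0_norm// mulrC mulKf ?gt_eqF// /K.
  by congr ps_sum; apply/funext => m; rewrite mul1r.
pose e n := \sum_(j < d.+1) (if (j <= n)%N then (Q j).[(n - j)%N%:R] * c (n - j)%N else 0).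
have eP z : `|z| < Defs.radius R l ->
    pseries e z @ \oo --> \sum_(j < d.+1) z ^+ j * op_eval K l.+1 (Q j) z.
  move=> zr; apply: cvg_pseries_sum => j _.
  apply: (@cvg_pseries_shift R (fun n => (Q j).[n%:R] * c n) z _ j).
  rewrite (_ : (fun n => _) = (fun n => \sum_(i < l.+1) (Q j)`_i * (n%:R ^+ i * c n))).
    apply: cvg_pseries_sum => i _; apply: cvg_pseriesZ.
    by apply: (ps_sumP (cvK i)).
  apply/funext => m; rewrite (horner_coef_wide _ (size_theta_coef _ _ _)) mulr_suml.
  by apply: eq_bigr => i _; rewrite mulrA.
rewrite big_mkcond; apply: (@ps_sum_eq0 R e (Defs.radius R l)) => // [z zr|z zr].
  by apply/cvg_ex; eexists; exact: eP.
have [z0 zl] := andP zr; rewrite (ps_sum_eq (eP z _)) ?gtr0_norm//.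
rewrite -[RHS](E z zr); apply: eq_bigr => j _; congr (_ * _).
by apply: eq_bigr => i _; rewrite HK// -ltnS.
Qed.

Theorem theta_coefE j : Q j = (-1) ^+ l *: bop R l j.
Proof.
have [d1 d2] := size_Delta_bound l_gt0.
case: j => [|j]; first by rewrite theta_coef0.
case: (ltnP j d) => jd; last first.
  rewrite bop_eq0 ?scaler0; last by lia.
  rewrite /theta_coef big1// => k _; rewrite nth_default ?scale0r//.
  by rewrite (leq_trans (size_pf_cofactor l_gt0 hB _))// -ltnS.
(* The shift by one uses that the terms of index 0 agree: [d] unknown coefficients are left instead
   of [d + 1]. *)
pose E i := Q i.+1 - (-1) ^+ l *: bop R l i.+1.
suff : E j = 0 by move/eqP; rewrite subr_eq0 => /eqP.
move: d1 d2 jd theta_coef_annihilates; move: (size (Delta l)) => D d1 d2 jD ann.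
apply: (banana_coef_operator_eq0 d1) jD => n.
have R1 := ann n.+1.
have R2 := bop_annihilates R n.+1 l_gt0.
have {}R2 : \sum_(j < D.+1 | (j <= n.+1)%N) (bop R l j).[(n.+1 - j)%N%:R] * c (n.+1 - j) = 0.
  pose F j := (bop R l j).[(n.+1 - j)%N%:R] * c (n.+1 - j)%N.
  rewrite -[RHS]R2 -(big_mkord (fun j => (j <= n.+1)%N) F) -(big_mkord xpredT F).
  rewrite (big_nat_widen _ _ (maxn D.+1 n.+2)) ?leq_maxl//.
  rewrite [RHS](big_nat_widen _ _ (maxn D.+1 n.+2)) ?leq_maxr//.
  rewrite big_mkcond [RHS]big_mkcond; apply: eq_bigr => i _.
  rewrite -[(i <= n.+1)%N]ltnS; case: (ltnP i n.+2) => //= ni; case: (ltnP i D.+1) => // di.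
  by rewrite /F bop_eq0 ?horner0 ?mul0r//; lia.
move: R1 R2; rewrite big_mkcond big_ord_recl => R1; rewrite big_mkcond big_ord_recl => R2.
have R3 := congr2 (fun x y => x - (-1) ^+ l * y) R1 R2.
rewrite mulr0 subr0 in R3; rewrite -[RHS]R3.
rewrite theta_coef0// hornerZ mulrDr opprD addrACA -mulrA subrr add0r big_mkcond.
rewrite mulr_sumr -sumrB; apply: eq_bigr => i _; rewrite /= /bump leq0n add1n ltnS subSS.
case: ifP => _; last by rewrite mulr0 subr0.
by rewrite /E hornerD hornerN hornerZ; ring.
Qed.

End Identification.

(** * The bilinear concomitant of a self-adjoint operator *)

Section Concomitant.
Variables (R : realType) (q : nat -> {poly R}) (D l : nat).

(** Coefficient of [theta^a H * theta^b K] in Lagrange's concomitant, where integrating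
    [z^j theta^k] by parts gives [sum_(b < k) (-1)^(k-1-b) theta^(k-1-b)(z^j H) theta^b K], and
    [theta^m (z^j H) = z^j (theta + j)^m H]. *)
Definition conc_mx (z : R) (a b : nat) : R :=
  \sum_(j < D) z ^+ j * \sum_(k < l.+1) (q j)`_k *
    (if (b < k)%N then (-1) ^+ (k.-1 - b) * (('X + j%:R%:P) ^+ (k.-1 - b))`_a else 0).

Definition conc (H K : nat -> R -> R) (z : R) : R :=
  \sum_(a < l) \sum_(b < l) conc_mx z a b * (H a z * K b z).

Lemma size_exp_XaddC (c : R) n : size (('X + c%:P) ^+ n) = n.+1.
Proof. by rewrite -[c]opprK polyCN size_exp_XsubC. Qed.

Lemma coef_exp_XaddC (c : R) n : (('X + c%:P) ^+ n)`_n = 1.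
Proof.
have /monicP : ('X + c%:P) ^+ n \is monic by rewrite monic_exp// monicXaddC.
by rewrite lead_coefE size_exp_XaddC.
Qed.

Lemma coef_exp_XaddC_gt (c : R) n a : (n < a)%N -> (('X + c%:P) ^+ n)`_a = 0.
Proof. by move=> na; rewrite nth_default// size_exp_XaddC. Qed.

Lemma conc_mx_eq0 z a b : (l <= a + b)%N -> conc_mx z a b = 0.
Proof.
move=> lab; rewrite /conc_mx big1// => j _; rewrite big1 ?mulr0// => k _.
case: ltnP => bk; last by rewrite mulr0.
by rewrite coef_exp_XaddC_gt ?mulr0//; have := ltn_ord k; lia.
Qed.

Lemma conc_mx_anti z a b : (a + b).+1 = l ->
  conc_mx z a b = (-1) ^+ a * \sum_(j < D) z ^+ j * (q j)`_l.
Proof.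
move=> lab; rewrite mulr_sumr; apply: eq_bigr => j _.
rewrite big_ord_recr /= big1 ?add0r => [|k _]; last first.
  case: ltnP => bk; last by rewrite mulr0.
  by rewrite coef_exp_XaddC_gt ?mulr0//; have := ltn_ord k; lia.
rewrite ifT; last by lia.
have -> : (l.-1 - b)%N = a by lia.
by rewrite coef_exp_XaddC; ring.
Qed.

Lemma concE H K z : conc H K z = \sum_(j < D) z ^+ j * \sum_(k < l.+1) (q j)`_k *
  \sum_(b < k) (-1) ^+ (k.-1 - b) * op_eval H l.+1 (('X + j%:R%:P) ^+ (k.-1 - b)) z * K b z.
Proof.
have E j k : (k <= l)%N -> \sum_(b < k) (-1) ^+ (k.-1 - b) *
    op_eval H l.+1 (('X + j%:R%:P) ^+ (k.-1 - b)) z * K b z =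
  \sum_(b < l) \sum_(a < l) (if (b < k)%N then
     (-1) ^+ (k.-1 - b) * (('X + j%:R%:P) ^+ (k.-1 - b))`_a else 0) * (H a z * K b z).
  move=> kl; rewrite [RHS](eq_bigr (fun b : 'I_l => if (b < k)%N then
     (-1) ^+ (k.-1 - b) * op_eval H l.+1 (('X + j%:R%:P) ^+ (k.-1 - b)) z * K b z else 0)).
    rewrite -big_mkcond /=.
    pose F b := (-1) ^+ (k.-1 - b) * op_eval H l.+1 (('X + j%:R%:P) ^+ (k.-1 - b)) z * K b z.
    by rewrite -(big_mkord xpredT F) (big_nat_widen _ _ l)// big_mkord.
  move=> b _; case: ltnP => bk; last by rewrite big1// => a _; rewrite mul0r.
  rewrite -(@op_eval_wide R H l l.+1)//; last by rewrite size_exp_XaddC; lia.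
  by rewrite mulr_sumr mulr_suml; apply: eq_bigr => a _; ring.
rewrite /conc exchange_big /=.
under [LHS]eq_bigr => b _ do under eq_bigr => a _ do rewrite mulr_suml.
under [LHS]eq_bigr => b _ do rewrite exchange_big /=.
rewrite exchange_big /=; apply: eq_bigr => j _.
under [LHS]eq_bigr => b _ do under eq_bigr => a _ do rewrite -mulrA mulr_suml.
under [LHS]eq_bigr => b _ do rewrite -mulr_sumr exchange_big /=.
rewrite -mulr_sumr exchange_big /=; congr (_ * _); apply: eq_bigr => k _.
rewrite E -1?ltnS// mulr_sumr; apply: eq_bigr => b _.
by rewrite mulr_sumr; apply: eq_bigr => a _; rewrite -mulrA.
Qed.

Variable r : R.
Hypothesis size_q : forall j, (size (q j) <= l.+1)%N.
Hypothesis adj_q : forall j, q j \Po (- 'X - j%:R%:P) = (-1) ^+ l *: q j.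

Lemma telescope_sign (x : nat -> R) k :
  \sum_(b < k) (-1) ^+ (k.-1 - b) * (x b.+1 + x b) = x k - (-1) ^+ k * x 0%N.
Proof.
elim: k => [|k IH]; first by rewrite big_ord0 mul1r subrr.
rewrite big_ord_recr /= subnn mul1r.
have -> : \sum_(i < k) (-1) ^+ (k - i) * (x i.+1 + x i) =
   - \sum_(b < k) (-1) ^+ (k.-1 - b) * (x b.+1 + x b).
  rewrite -sumrN; apply: eq_bigr => i _.
  have -> : (k - i)%N = (k.-1 - i).+1 by have := ltn_ord i; lia.
  by rewrite exprS; ring.
by rewrite IH exprS; ring.
Qed.

(** Lagrange's identity: the [theta]-derivative of the concomitant is [H 0 * L K - adj(L) H * K 0],
    and [adj(L) = (-1)^l L] annihilates [H]. *)
Lemma theta_on_conc H K :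
  (forall i, (i < l)%N -> theta_on r (H i) (H i.+1)) ->
  (forall i, (i < l)%N -> theta_on r (K i) (K i.+1)) ->
  (forall z, 0 < z < r -> \sum_(j < D) z ^+ j * op_eval H l.+1 (q j) z = 0) ->
  (forall z, 0 < z < r -> \sum_(j < D) z ^+ j * op_eval K l.+1 (q j) z = 0) ->
  theta_on r (conc H K) (fun=> 0).
Proof.
move=> HH KK LH LK.
pose u j a := op_eval H l.+1 (('X + j%:R%:P) ^+ a).
have zu j a : (a < l)%N -> theta_on r (fun z => z ^+ j * u j a z) (fun z => z ^+ j * u j a.+1 z).
  move=> al; have su : (size (('X + j%:R%:P : {poly R}) ^+ a) <= l)%N by rewrite size_exp_XaddC.
  apply: (eq_theta_on (theta_onM (@theta_onXn R r j) (theta_on_op_eval HH su))) => // z _.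
  by rewrite /u exprS mulrDl op_evalD mul_polyC op_evalZ; ring.
have T j k : (k <= l)%N -> theta_on r
    (fun z => \sum_(b < k) (-1) ^+ (k.-1 - b) * ((z ^+ j * u j (k.-1 - b)%N z) * K b z))
    (fun z => z ^+ j * (u j 0%N z * K k z - (-1) ^+ k * (u j k z * K 0%N z))).
  move=> kl.
  have Tb (b : 'I_k) : theta_on r
     (fun z => (-1) ^+ (k.-1 - b) * ((z ^+ j * u j (k.-1 - b)%N z) * K b z))
     (fun z => (-1) ^+ (k.-1 - b) * ((z ^+ j * u j (k.-1 - b).+1 z) * K b z
                 + (z ^+ j * u j (k.-1 - b)%N z) * K b.+1 z)).
    have bk := ltn_ord b.
    by apply: theta_onZ; apply: theta_onM; [apply: zu; lia|apply: KK; lia].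
  apply: (eq_theta_on (@theta_on_sum _ _ _ (index_enum _) xpredT _ _ (fun b _ => Tb b))) => // z _.
  pose x b := u j (k - b)%N z * K b z.
  have := telescope_sign x k; rewrite /x subnn subn0 => <-; rewrite mulr_sumr.
  apply: eq_bigr => b _; have bk := ltn_ord b.
  have -> : (k - b.+1 = k.-1 - b)%N by lia.
  have -> : (k - b = (k.-1 - b).+1)%N by lia.
  by ring.
have C := @theta_on_sum R r 'I_D (index_enum _) xpredT _ _ (fun (j : 'I_D) _ =>
  @theta_on_sum R r 'I_l.+1 (index_enum _) xpredT _ _ (fun (k : 'I_l.+1) _ =>
    theta_onZ ((q j)`_k) (T j k (leq_ord k)))).
apply: (eq_theta_on C) => z zr.
  rewrite concE; apply: eq_bigr => j _; rewrite mulr_sumr; apply: eq_bigr => k _.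
  rewrite mulrCA; congr (_ * _); rewrite mulr_sumr; apply: eq_bigr => b _.
  by rewrite /u; ring.
have qP j : q j = \sum_(k < l.+1) (q j)`_k *: 'X^k.
  rewrite -poly_def; apply/polyP => i; rewrite coef_poly; case: ltnP => // li.
  by rewrite nth_default// (leq_trans (size_q j)).
have qA j : (-1) ^+ l *: q j = \sum_(k < l.+1) (q j)`_k *: ((-1) ^+ k *: ('X + j%:R%:P) ^+ k).
  rewrite -adj_q {1}[q j]qP linear_sum; apply: eq_bigr => k _.
  rewrite /= comp_polyZ rmorphXn /= comp_polyX -opprD [in LHS]exprNn; congr (_ *: _).
  by rewrite -[in LHS]signr_odd mulr_sign -[in RHS]signr_odd scaler_sign.
transitivity (H 0%N z * (\sum_(j < D) z ^+ j * op_eval K l.+1 (q j) z)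
   - (-1) ^+ l * K 0%N z * (\sum_(j < D) z ^+ j * op_eval H l.+1 (q j) z)); last first.
  by rewrite LH// LK// !mulr0 subrr.
rewrite !mulr_sumr -sumrB; apply: eq_bigr => j _.
have -> : H 0%N z * (z ^+ j * op_eval K l.+1 (q j) z) -
  (-1) ^+ l * K 0%N z * (z ^+ j * op_eval H l.+1 (q j) z) =
  z ^+ j * (H 0%N z * op_eval K l.+1 (q j) z - op_eval H l.+1 ((-1) ^+ l *: q j) z * K 0%N z).
  by rewrite op_evalZ; ring.
have -> : op_eval K l.+1 (q j) z = \sum_(k < l.+1) (q j)`_k * K k z by [].
rewrite qA op_eval_sum mulr_suml mulr_sumr -sumrB mulr_sumr.
apply: eq_bigr => k _; rewrite !op_evalZ /u expr0.
have := @op_evalXn R H l.+1 0 z isT; rewrite expr0 => ->.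
by ring.
Qed.

End Concomitant.

(** * Logarithmic asymptotics at [0+] *)

Section LogAsymptotics.
Variable R : realType.
Implicit Types (h k s : R -> R) (P Q : {poly R}).

(** Asking for all powers makes the class stable under multiplication by polynomials in [ln z],
    unbounded as they are. *)
Definition log_small s := forall N : nat, ln z ^+ N * s z @[z --> 0^'+] --> (0 : R).

(* [h] agrees with the polynomial [P] in [ln z], up to terms that are
   negligible against every power of [ln z]. *)
Definition log_asym h P := log_small (fun z => h z - P.[ln z]).

Lemma eq_log_small s1 s2 e : 0 < e -> (forall z, 0 < z < e -> s1 z = s2 z) ->
  log_small s1 -> log_small s2.
Proof.
move=> e0 ss L N; apply: cvg_trans (L N); apply: near_eq_cvg; near=> z.
rewrite ss//; apply/andP; split; near: z; first exact: nbhs_right_gt.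
exact: nbhs_right_lt.
Unshelve. all: by end_near. Qed.

Lemma log_smallD s1 s2 : log_small s1 -> log_small s2 -> log_small (fun z => s1 z + s2 z).
Proof.
move=> L1 L2 N; rewrite (_ : (fun z => _) = (fun z => ln z ^+ N * s1 z + ln z ^+ N * s2 z)).
  by rewrite -[X in _ --> X]addr0; apply: cvgD; [exact: L1|exact: L2].
by apply/funext => z; rewrite mulrDr.
Qed.

Lemma log_small_cvgM s g (c : R) : log_small s -> g z @[z --> 0^'+] --> c ->
  log_small (fun z => s z * g z).
Proof.
move=> L gc N; rewrite (_ : (fun z => _) = (fun z => (ln z ^+ N * s z) * g z)).
  by rewrite -[X in _ --> X](mul0r c); apply: cvgM => //; exact: L.
by apply/funext => z; rewrite mulrA.
Qed.

Lemma log_smallZ s (c : R) : log_small s -> log_small (fun z => s z * c).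
Proof. by move=> L; apply: log_small_cvgM L (cvg_cst c). Qed.

Lemma log_small_cvg0 s : log_small s -> s z @[z --> 0^'+] --> (0 : R).
Proof.
move=> /(_ 0%N); rewrite (_ : (fun z => _) = s)//.
by apply/funext => z; rewrite mul1r.
Qed.

Lemma log_smallM s1 s2 : log_small s1 -> log_small s2 -> log_small (fun z => s1 z * s2 z).
Proof. by move=> L1 /log_small_cvg0 L2; exact: log_small_cvgM L1 L2. Qed.

Lemma log_small0 : log_small (fun=> 0).
Proof.
by move=> N; rewrite (_ : (fun z => _) = fun=> 0); [exact: cvg_cst|apply/funext => z; rewrite mulr0].
Qed.

Lemma log_small_poly s P : log_small s -> log_small (fun z => s z * P.[ln z]).
Proof.
move=> L; elim/poly_ind: P => [|P c IH].
  rewrite (_ : (fun z => _) = fun=> 0); first exact: log_small0.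
  by apply/funext => z; rewrite horner0 mulr0.
rewrite (_ : (fun z => _) = (fun z => ln z * (s z * P.[ln z]) + s z * c)).
  apply: log_smallD; last exact: log_smallZ.
  move=> N; rewrite (_ : (fun z => _) = (fun z => ln z ^+ N.+1 * (s z * P.[ln z]))).
    exact: IH.
  by apply/funext => z; rewrite exprSr mulrA.
by apply/funext => z; rewrite hornerMXaddC; ring.
Qed.

Lemma log_small_id : log_small id.
Proof.
(* With [x = z^(1/(N+1))] one has [(ln z)^N z = (N+1)^N (x ln x)^N x]; since [|x ln x| <= 1], a
   multiple of a positive power of [z] remains. *)
move=> N; pose a : R := N.+1%:R^-1; have a0 : 0 < a by rewrite invr_gt0 ltr0n.
have b z : 0 < z < 1 -> `|ln z ^+ N * z| <= N.+1%:R ^+ N * (z `^ a).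
  move=> /andP[z0 z1]; pose x := z `^ a; have x0 : 0 < x by rewrite powR_gt0.
  have xN : z = x ^+ N.+1.
    by rewrite -powR_mulrn ?powR_ge0// -powRrM mulVf ?pnatr_eq0// powRr1// ltW.
  have lnz : ln z = N.+1%:R * ln x.
    by rewrite {1}xN lnXn// mulr_natl.
  have lx0 : ln x <= 0.
    have := ln_lt0 (x := z); rewrite z0 z1 => /(_ isT); rewrite lnz pmulr_rlt0 ?ltr0n// => /ltW.
    by [].
  have lx : `|ln x| * x <= 1.
    rewrite ler0_norm// -ler_pdivlMr// mul1r -lnV ?posrE//.
    by apply/ltW/ln_sublinear; rewrite invr_gt0.
  rewrite {1}lnz {1}xN exprMn exprS !normrM !normrX normr_nat [`|x|]gtr0_norm//.
  rewrite -mulrA.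
  rewrite ler_wpM2l ?exprn_ge0// mulrCA -[leRHS]mulr1 ler_wpM2l ?(ltW x0)//.
  rewrite -exprMn.
  by rewrite exprn_ile1// mulr_ge0// ltW.
have c0 : N.+1%:R ^+ N * (z `^ a) @[z --> 0^'+] --> (0 : R).
  by rewrite -[X in _ --> X](mulr0 (N.+1%:R ^+ N : R)); apply: cvgMl_tmp; exact: powR_cvg0.
apply: norm_cvg0; apply: squeeze_cvgr (cvg_cst (0 : R)) c0.
near=> z; rewrite normr_ge0 /=; apply: b; apply/andP; split; near: z.
  exact: nbhs_right_gt.
exact: nbhs_right_lt.
Unshelve. all: by end_near. Qed.

Lemma log_asymD h k P Q : log_asym h P -> log_asym k Q -> log_asym (fun z => h z + k z) (P + Q).
Proof.
move=> hP kQ; rewrite /log_asym (_ : (fun z => _) = fun z => (h z - P.[ln z]) + (k z - Q.[ln z])).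
  exact: log_smallD.
by apply/funext => z; rewrite hornerD; ring.
Qed.

Lemma log_asymM h k P Q : log_asym h P -> log_asym k Q -> log_asym (fun z => h z * k z) (P * Q).
Proof.
move=> hP kQ; rewrite /log_asym (_ : (fun z => _) =
  fun z => (h z - P.[ln z]) * (k z - Q.[ln z]) + ((h z - P.[ln z]) * Q.[ln z]
   + (k z - Q.[ln z]) * P.[ln z])).
  by apply: log_smallD; [exact: log_smallM|apply: log_smallD; exact: log_small_poly].
by apply/funext => z; rewrite hornerM; ring.
Qed.

Lemma log_asym_cst (c : R) : log_asym (fun=> c) c%:P.
Proof.
rewrite /log_asym (_ : (fun z => _) = fun=> 0); first exact: log_small0.
by apply/funext => z; rewrite hornerC subrr.
Qed.

Lemma log_asym_sum (I : Type) (r : seq I) (C : pred I) (F : I -> R -> R) (G : I -> {poly R}) :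
  (forall i, C i -> log_asym (F i) (G i)) ->
  log_asym (fun z => \sum_(i <- r | C i) F i z) (\sum_(i <- r | C i) G i).
Proof.
move=> FG; elim: r => [|i r IH].
  rewrite big_nil (_ : (fun z => _) = fun=> 0); first exact: log_asym_cst.
  by apply/funext => z; rewrite big_nil.
rewrite big_cons (_ : (fun z => _) = fun z => if C i then F i z + \sum_(j <- r | C j) F j z
   else \sum_(j <- r | C j) F j z); last by apply/funext => z; rewrite big_cons.
by case: ifP => // Ci; apply: log_asymD => //; exact: FG.
Qed.

Lemma log_asym_ln : log_asym (@ln R) 'X.
Proof.
rewrite /log_asym (_ : (fun z => _) = fun=> 0); first exact: log_small0.
by apply/funext => z; rewrite hornerX subrr.
Qed.

Lemma log_asymX h P n : log_asym h P -> log_asym (fun z => h z ^+ n) (P ^+ n).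
Proof.
move=> hP; elim: n => [|n IH]; first exact: (log_asym_cst 1).
rewrite (_ : (fun z => _) = fun z => h z * h z ^+ n); last by apply/funext => z; rewrite exprS.
by rewrite exprS; exact: log_asymM.
Qed.

Lemma log_asym_id : log_asym id 0.
Proof.
rewrite /log_asym (_ : (fun z => _) = id); first exact: log_small_id.
by apply/funext => z; rewrite horner0 subr0.
Qed.

Lemma eq_log_asym h1 h2 P e : 0 < e -> (forall z, 0 < z < e -> h1 z = h2 z) ->
  log_asym h1 P -> log_asym h2 P.
Proof. by move=> e0 hh; apply: eq_log_small e0 _ => z ze; rewrite hh. Qed.

Lemma log_asym_ps_sum c e : 0 < e -> ps_conv c e -> log_asym (ps_sum c) (c 0%N)%:P.
Proof.
move=> e0 cc; have cb := ps_conv_behead e0 cc.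
apply: (eq_log_small (s1 := fun z => z * ps_sum (fun n => c n.+1) z) e0) => [z /andP[z0 ze]|].
  rewrite hornerC (ps_sum_behead cc) ?gtr0_norm ?gt_eqF//.
  by rewrite addrC addKr.
exact: log_small_cvgM log_small_id (cvg_ps_sum0 e0 cb).
Qed.

Lemma log_asym_unique (C c : R) e : 0 < e -> forall h, (forall z, 0 < z < e -> h z = C) ->
  log_asym h c%:P -> C = c.
Proof.
move=> e0 h hC /log_small_cvg0 L; apply/eqP; rewrite -subr_eq0; apply/eqP.
have L2 : h z - c%:P.[ln z] @[z --> 0^'+] --> C - c.
  apply: cvg_near_cst; near=> z; rewrite hornerC hC//; apply/andP; split; near: z.
    exact: nbhs_right_gt.
  exact: nbhs_right_lt.
exact: (cvg_unique _ L2 L).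
Unshelve. all: by end_near. Qed.

End LogAsymptotics.

Section LogPolynomials.
Variable R : realType.

(** The [a]-th derivative of [t^k / k!]: with [t = ln z] it is the leading part of
    [theta^a (varpi k / z)]. *)
Definition log_mono (k a : nat) : {poly R} :=
  if (a <= k)%N then (k - a)`!%:R^-1 *: 'X^(k - a) else 0.

Lemma deriv_log_mono k a : (log_mono k a)^`() = log_mono k a.+1.
Proof.
rewrite /log_mono; case: (leqP a k) => ak; last by rewrite deriv0 ifF//; lia.
rewrite derivZ derivXn; case: ltnP => ka; last first.
  by rewrite (_ : (k - a)%N = 0%N) ?mulr0n ?scaler0//; lia.
rewrite (_ : (k - a)%N = (k - a.+1).+1) /=; last by lia.
by rewrite -scalerMnr scalerMnl -mulr_natr factS natrM invfM mulrAC mulVf ?mul1r.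
Qed.

Lemma log_mono0 k a : (log_mono k a)`_0 = (a == k)%:R.
Proof.
rewrite /log_mono; case: ltngtP => ak; rewrite ?coef0//.
  by rewrite coefZ coefXn (_ : (0%N == (k - a)%N) = false) ?mulr0//; lia.
by rewrite ak subnn coefZ coefXn eqxx fact0 invr1 mulr1.
Qed.

Lemma deriv_eq0 (p : {poly R}) : p^`() = 0 -> p = (p`_0)%:P.
Proof.
move=> p0; apply/polyP => -[|n]; rewrite coefC//=.
have := congr1 (fun p : {poly R} => p`_n) p0.
rewrite coef_deriv coef0 -mulr_natr => /eqP.
by rewrite mulf_eq0 pnatr_eq0 orbF => /eqP.
Qed.

(* The concomitant of [(d/dt)^l] is constant on polynomials of degree [< l];
   it is evaluated at [t = 0]. *)
Lemma log_mono_concomitant l i j : (i < l)%N -> (j < l)%N ->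
  \sum_(a < l) (-1) ^+ a *: (log_mono i a * log_mono j (l.-1 - a)) =
  (if (i + j).+1 == l then (-1) ^+ i else 0)%:P.
Proof.
move=> il jl.
have ll k : (k < l)%N -> log_mono k l = 0 by move=> kl; rewrite /log_mono leqNgt kl.
rewrite [LHS]deriv_eq0.
  congr (_%:P); rewrite coef_sum.
  have E (a : 'I_l) : ((-1) ^+ a *: (log_mono i a * log_mono j (l.-1 - a)))`_0 =
    if a == i :> nat then (if (i + j).+1 == l then (-1) ^+ i else 0) else 0.
    rewrite coefZ coef0M !log_mono0; case: eqP => [ai|_]; last by rewrite mul0r mulr0.
    rewrite mul1r ai; have -> : (l.-1 - i == j)%N = ((i + j).+1 == l) by apply/eqP/eqP; lia.
    by case: eqP => _; rewrite ?mulr1 ?mulr0.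
  rewrite (eq_bigr _ (fun a _ => E a)) (bigD1 (Ordinal il))//= eqxx big1 ?addr0// => a ai.
  by rewrite ifN.
rewrite linear_sum /=.
pose x a : {poly R} := log_mono i a * log_mono j (l - a).
have T n : \sum_(a < n) (-1) ^+ a *: (x a.+1 + x a) = x 0%N - (-1) ^+ n *: x n.
  elim: n => [|n IH]; first by rewrite big_ord0 scale1r subrr.
  by rewrite big_ord_recr /= IH exprS mulN1r scaleNr scalerDr opprK addrA addrAC subrK.
have := T l; rewrite /x subn0 subnn !ll// mulr0 mul0r scaler0 subr0 => E; rewrite -[RHS]E.
apply: eq_bigr => a _; have al := ltn_ord a.
rewrite derivZ derivM !deriv_log_mono.
have -> : (l - a.+1 = l.-1 - a)%N by lia.
by have -> : (l - a = (l.-1 - a).+1)%N by lia.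
Qed.

End LogPolynomials.

(** * Logarithmic expansions of the jets of the Frobenius basis *)

Section LogExpansion.
Variables (R : realType) (c : nat -> nat -> R) (e : R) (k : nat).
Hypothesis e_gt0 : 0 < e.
Hypothesis c_conv : forall j, (j <= k)%N -> ps_conv (c j) e.

(* [theta^a (f / z) = sum_i ln z ^ i / i! sum_n log_coef a i n z^n] for
   [f = sum_j ln z ^ (k - j) / (k - j)! sum_n c j n z^n]. *)
Fixpoint log_coef (a i n : nat) : R :=
  if a is a'.+1 then n%:R * log_coef a' i n + log_coef a' i.+1 n
  else if (i <= k)%N then c (k - i) n.+1 else 0.

Definition log_series a z : R :=
  \sum_(i < k.+1) i`!%:R^-1 * (ln z ^+ i * ps_sum (log_coef a i) z).

Lemma log_coef_gt a i n : (k < i)%N -> log_coef a i n = 0.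
Proof.
elim: a i => [|a IH] i ki /=; first by rewrite leqNgt ki.
by rewrite !IH ?mulr0 ?addr0// ltnW.
Qed.

Lemma log_coef_0 a i : log_coef a i 0 = log_coef 0 (a + i) 0.
Proof.
by elim: a i => [//|a IH] i; rewrite [LHS]/= mul0r add0r IH addnS addSn.
Qed.

Lemma ps_conv_log_coef a i : ps_conv (log_coef a i) e.
Proof.
elim: a i => [|a IH] i /=; last first.
  by apply: ps_convD; [case: (theta_on_ps_sum e_gt0 (IH i))|exact: IH].
case: leqP => ik; last exact: ps_conv0.
by apply: ps_conv_behead => //; apply: c_conv; exact: leq_subr.
Qed.

Lemma theta_on_log_series a : theta_on e (log_series a) (log_series a.+1).
Proof.
have T (i : 'I_k.+1) : theta_on e (fun z => i`!%:R^-1 * (ln z ^+ i * ps_sum (log_coef a i) z))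
  (fun z => i`!%:R^-1 * ((i%:R * ln z ^+ i.-1 * 1) * ps_sum (log_coef a i) z +
     ln z ^+ i * ps_sum (fun n => n%:R * log_coef a i n) z)).
  apply: theta_onZ; apply: theta_onM; first exact: theta_onX (@theta_on_ln R e).
  by have [] := theta_on_ps_sum e_gt0 (@ps_conv_log_coef a i).
apply: (eq_theta_on (@theta_on_sum _ _ _ (index_enum _) xpredT _ _ (fun i _ => T i))) => // z /andP[z0 ze].
have ze' : `|z| < e by rewrite gtr0_norm.
have S i : ps_sum (log_coef a.+1 i) z = ps_sum (fun n => n%:R * log_coef a i n) z + ps_sum (log_coef a i.+1) z.
  rewrite -(@ps_sumD R _ _ e)//; last exact: ps_conv_log_coef.
  by case: (theta_on_ps_sum e_gt0 (@ps_conv_log_coef a i)).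
rewrite /log_series; under [RHS]eq_bigr => i _ do rewrite S !mulrDr addrC.
under [LHS]eq_bigr => i _ do rewrite mulrDr.
rewrite !big_split /=; congr (_ + _).
rewrite big_ord_recl mul0r !(mul0r, mulr0) add0r.
rewrite [RHS]big_ord_recr /= [ps_sum (log_coef a k.+1) z](_ : _ = 0) ?mulr0 ?addr0; last first.
  rewrite (_ : log_coef a k.+1 = fun=> 0); last by apply/funext => n; exact: log_coef_gt.
  by apply: ps_sum_eq; exact: cvg_pseries0.
apply: eq_bigr => i _; rewrite /bump leq0n add1n factS natrM invfM /= mulr1.
by field; rewrite pnatr_eq0 -lt0n fact_gt0 addrC natr1 pnatr_eq0.
Qed.

(** At [z = 0], [theta] acts on the powers of [ln z] alone, and by the normalization only the series
    with index 0 has a constant term after division by [z]. A single power of [ln z] survives. *)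
Lemma log_asym_log_series a : (forall j, (j <= k)%N -> c j 1%N = (j == 0%N)%:R) ->
  log_asym (log_series a) (log_mono R k a).
Proof.
move=> c1.
have -> : log_mono R k a = \sum_(i < k.+1) i`!%:R^-1%:P * ('X ^+ i * (log_coef a i 0)%:P).
  have E (i : 'I_k.+1) : i`!%:R^-1%:P * ('X ^+ i * (log_coef a i 0)%:P) =
     if (a + i == k)%N then i`!%:R^-1 *: 'X^i else 0 :> {poly R}.
    rewrite log_coef_0 /=; case: ifPn => [aik|]; last first.
      by case: eqP => [->|_ _]; rewrite ?leqnn// !mulr0.
    rewrite c1 ?leq_subr//; have -> : (k - (a + i) == 0)%N = (a + i == k)%N by apply/eqP/eqP; lia.
    by case: eqP => _; rewrite ?mulr0// mulr1 mul_polyC.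
  rewrite (eq_bigr _ (fun i _ => E i)) /log_mono; case: leqP => ak; last first.
    by rewrite big1// => i _; rewrite ifN//; apply/eqP; lia.
  have ki : (k - a < k.+1)%N by lia.
  rewrite (bigD1 (Ordinal ki))//= subnKC// eqxx big1 ?addr0// => i ik.
  rewrite ifN//; apply: contra ik => /eqP aik; apply/eqP/val_inj => /=; lia.
apply: log_asym_sum => i _; apply: log_asymM; first exact: log_asym_cst.
apply: log_asymM; first exact/log_asymX/log_asym_ln.
exact: log_asym_ps_sum e_gt0 (@ps_conv_log_coef a i).
Qed.

End LogExpansion.

(** Positive powers of [z] are negligible, and the term [j = 0] is the concomitant of [theta^l]. *)
Lemma log_asym_conc_mx (R : realType) (l D a b : nat) : (a < l)%N -> (b < l)%N ->
  log_asym (fun z : R => conc_mx (bop R l) D.+1 l z a b)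
    (if (a + b).+1 == l then (-1) ^+ a else 0)%:P.
Proof.
move=> al bl; pose C j : R := \sum_(k < l.+1) (bop R l j)`_k *
    (if (b < k)%N then (-1) ^+ (k.-1 - b) * (('X + j%:R%:P) ^+ (k.-1 - b))`_a else 0).
have -> : (if (a + b).+1 == l then (-1) ^+ a else 0)%:P =
    \sum_(j < D.+1) (if j == 0%N :> nat then 1 else 0) * (C j)%:P.
  rewrite big_ord_recl /= mul1r big1 ?addr0; last by move=> j _; rewrite mul0r.
  congr (_%:P); rewrite /C big_ord_recr /= big1 ?add0r => [|k _]; last first.
    by rewrite coefXn (ltn_eqF (ltn_ord k)) mul0r.
  rewrite coefXn eqxx mul1r bl addr0 coefXn.
  have -> : (a == l.-1 - b)%N = ((a + b).+1 == l) by apply/eqP/eqP; lia.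
  case: eqP => [E|_]; last by rewrite mulr0.
  by rewrite mulr1; congr (_ ^+ _); lia.
apply: log_asym_sum => j _; apply: log_asymM; last exact: log_asym_cst.
case: (nat_of_ord j) => [|n] /=.
  by rewrite (_ : (fun z => _) = fun=> 1); [exact: log_asym_cst|apply/funext => z; rewrite expr0].
have := log_asymX n.+1 (@log_asym_id R); rewrite expr0n //=.
Qed.

(** * Quadratic relations *)

Section QuadraticRelations.
Variables (R : realType) (l : nat) (B : nat -> {poly R}) (varpi : nat -> R -> R).
Hypotheses (l_gt0 : (0 < l)%N) (hB : banana_PF l B).
Hypothesis hvarpi : frobenius_basis l B varpi.

Local Notation d := (size (Delta l)).
Local Notation r := (Defs.radius R l).

Definition theta_jet (i a : nat) : R -> R :=
  iter a (@theta_fun R) (fun z => varpi i z / z).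

Lemma theta_on_theta_jet i a : (i < l)%N -> (a < l)%N ->
  theta_on r (theta_jet i a) (theta_jet i a.+1).
Proof.
move=> il al; have [sv _] := hvarpi.
by have [H _] := solves_op_eval l_gt0 hB (sv i il); exact: H.
Qed.

Lemma theta_jet_bop i z : (i < l)%N -> 0 < z < r ->
  \sum_(j < d.+1) z ^+ j * op_eval (theta_jet i) l.+1 (bop R l j) z = 0.
Proof.
move=> il zr; have [sv _] := hvarpi.
have [_ /(_ z zr) E] := solves_op_eval l_gt0 hB (sv i il).
rewrite -[LHS]mul1r -(sqrr_sign R l) expr2 -mulrA; apply/eqP.
rewrite mulf_eq0 signr_eq0 /= mulr_sumr -[X in _ == X]E; apply/eqP/eq_bigr => j _.
by rewrite theta_coefE// op_evalZ mulrCA.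
Qed.

Lemma log_asym_theta_jet i a : (i < l)%N -> log_asym (theta_jet i a) (log_mono R i a).
Proof.
move=> il; have [_ [Sig [c [e [e0 cS c01 vE]]]]] := hvarpi.
have cc j : (j <= i)%N -> ps_conv (c j) e.
  by move=> ji z ze; apply/cvg_ex; exists (Sig j z); apply: cS => //; exact: leq_ltn_trans il.
have r0 := radius_gt0 R l.
pose e' := Num.min e r; have e'0 : 0 < e' by rewrite lt_min e0.
apply: (eq_log_asym e'0 (h1 := log_series c i a)); last first.
  apply: (log_asym_log_series e0 cc) => j ji.
  by have [] := c01 j (leq_ltn_trans ji il).
move=> z ze'; apply/esym.
apply: (@iter_theta_fun_eq R e' _ (log_series c i) a) => // [x xe|j _].
  have /andP[x0] := xe; rewrite lt_min => /andP[xlt xr].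
  rewrite vE ?x0// /log_series mulr_suml.
  rewrite (reindex_inj rev_ord_inj) /=; apply: eq_bigr => j _.
  have ji : (j <= i)%N by rewrite -ltnS.
  rewrite subSS (subKn ji) -!mulrA; congr (_ * (_ * _)).
  have ij : (i - j < l)%N by rewrite (leq_ltn_trans (leq_subr _ _)).
  have xe1 : `|x| < e by rewrite gtr0_norm.
  have [c0 _] := c01 _ ij.
  rewrite [ps_sum _ x](_ : _ = ps_sum (fun n => c (i - j)%N n.+1) x); last first.
    by congr ps_sum; apply/funext => n /=; rewrite ji.
  have <- : ps_sum (c (i - j)%N) x = Sig (i - j)%N x.
    by apply: ps_sum_eq; exact: cS.
  rewrite (ps_sum_behead (cc _ (leq_subr _ _)) xe1) ?gt_eqF// c0 add0r mulrC mulKf ?gt_eqF//.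
apply: theta_onW (theta_on_log_series e0 cc j).
by rewrite ge_min lexx.
Qed.


Lemma conc_theta_jet i j z : (i < l)%N -> (j < l)%N -> 0 < z < r ->
  conc (bop R l) d.+1 l (theta_jet i) (theta_jet j) z =
  if (i + j).+1 == l then (-1) ^+ i else 0.
Proof.
move=> il jl zr; set h := conc _ _ _ _ _.
have th : theta_on r h (fun=> 0).
  apply: theta_on_conc => [k|k|a al|a al|x xr|x xr].
  - exact: size_bop.
  - exact: bop_adjoint.
  - exact: theta_on_theta_jet.
  - exact: theta_on_theta_jet.
  - exact: theta_jet_bop.
  - exact: theta_jet_bop.
apply: (log_asym_unique (radius_gt0 R l) (h := h)) => [x xr|].
  exact: theta_on0_cst th _ _ xr zr.
(* The limit problem is that of [(d/dt)^l] acting on [t^i / i!] and [t^j / j!], with [t = ln z]. *)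
rewrite -log_mono_concomitant//.
have -> : \sum_(a < l) (-1) ^+ a *: (log_mono R i a * log_mono R j (l.-1 - a)) =
   \sum_(a < l) \sum_(b < l) (if (a + b).+1 == l then (-1) ^+ a else 0)%:P *
     (log_mono R i a * log_mono R j b).
  apply: eq_bigr => a _; have al := ltn_ord a.
  have bl : (l.-1 - a < l)%N by lia.
  rewrite (bigD1 (Ordinal bl))//= big1 ?addr0 => [|b bb].
    by rewrite ifT ?mul_polyC//; apply/eqP; lia.
  rewrite ifN ?mul0r//; apply: contra bb => /eqP bE.
  by apply/eqP/val_inj => /=; lia.
apply: log_asym_sum => a _; apply: log_asym_sum => b _.
apply: log_asymM; first exact: log_asym_conc_mx.
by apply: log_asymM; exact: log_asym_theta_jet.
Qed.

Lemma pf_discr_gt0 z : 0 < z < r -> 0 < (pf_discr R l).[z].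
Proof.
move=> /andP[z0 zr]; rewrite horner_prod big_seq.
apply: (big_ind (fun x : R => 0 < x)) => [||m mD]; [exact: ltr01|exact: mulr_gt0|].
rewrite !hornerE subr_gt0; have := Delta_le mD => ml.
apply: (@le_lt_trans _ _ (l.+1%:R ^+ 2 * z)).
  by rewrite ler_wpM2r ?(ltW z0)// -natrX ler_nat.
by move: zr; rewrite /Defs.radius -[_^-1]mul1r ltr_pdivlMr ?exprn_gt0// mulrC.
Qed.

(** This is not read off the definition of [bop]: it holds because [bop] has been identified with
    the given operator, whose leading coefficient is prescribed. *)
Lemma bop_lead_sum z : \sum_(j < d.+1) z ^+ j * (bop R l j)`_l = (pf_discr R l).[z].
Proof.
rewrite (@horner_coef_wide _ d.+1); last by rewrite size_pf_discr.
apply: eq_bigr => j _; rewrite mulrC; congr (_ * _).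
have := theta_coef_lead l B j; rewrite theta_coefE// coefZ pf_cofactor_lead// coefZ.
by move/(mulfI _) => ->//; rewrite signr_eq0.
Qed.

Definition jet_form (a : nat) (z : R) : R :=
  \sum_(i < l) \sum_(j < l) theta_jet i 0 z * SigmaM R l i j * theta_jet j a z.

Lemma SigmaM_trmx : (SigmaM R l)^T = (-1) ^+ l.-1 *: SigmaM R l.
Proof.
apply/matrixP => i j; rewrite !mxE addnC; case: eqP => [E|_]; last by rewrite mulr0.
rewrite -exprD -signr_odd -[in RHS]signr_odd; congr (_ ^+ _); congr (nat_of_bool _).
have -> : (l.-1 + i = j + i.*2)%N by lia.
by rewrite oddD odd_double addbF.
Qed.

Lemma SigmaM_mul_trmx : (SigmaM R l)^T *m SigmaM R l = 1%:M.
Proof.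
apply/matrixP => i j; rewrite !mxE.
have il := ltn_ord i; have bl : (l.-1 - i < l)%N by lia.
rewrite (bigD1 (Ordinal bl))//= big1 ?addr0 => [|k kb]; rewrite !mxE /=.
  rewrite ifT; last by apply/eqP; lia.
  have -> : ((l.-1 - i + j).+1 == l) = (i == j) by rewrite -val_eqE; apply/eqP/eqP => /=; lia.
  by case: eqP => _; rewrite ?mulr0// -expr2 sqrr_sign.
rewrite ifN ?mul0r//; apply: contra kb => /eqP kE.
by apply/eqP/val_inj => /=; lia.
Qed.

Lemma jet_formE a z : (a < l)%N -> 0 < z < r ->
  jet_form a z = if a == l.-1 then (pf_discr R l).[z]^-1 else 0.
Proof.
move=> al zr; have D0 := lt0r_neq0 (pf_discr_gt0 zr).
pose Phi : 'M[R]_l := \matrix_(a < l, i < l) theta_jet i a z.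
pose M : 'M[R]_l := \matrix_(a < l, b < l) conc_mx (bop R l) d.+1 l z a b.
have PMP : Phi^T *m M *m Phi = SigmaM R l.
  apply/matrixP => i j; rewrite !mxE -(conc_theta_jet (ltn_ord i) (ltn_ord j) zr).
  rewrite /conc exchange_big; apply: eq_bigr => b _; rewrite !mxE mulr_suml.
  by apply: eq_bigr => k _; rewrite !mxE; ring.
pose G := Phi *m (SigmaM R l)^T *m Phi^T.
(* Invertibility of the Wronskian matrix need not be known beforehand: [PMP] and the orthogonality
   of [SigmaM] exhibit a one-sided inverse of [Phi], and for square matrices the factors may be
   exchanged. *)
have GM : G *m M = 1%:M.
  have : (SigmaM R l)^T *m Phi^T *m M *m Phi = 1%:M.
    by rewrite -!mulmxA (mulmxA Phi^T) PMP SigmaM_mul_trmx.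
  by move/mulmx1C; rewrite /G !mulmxA.
have GE (b : 'I_l) : jet_form b z = (-1) ^+ l.-1 * G (Ordinal l_gt0) b.
  rewrite /G SigmaM_trmx -scalemxAr -scalemxAl mxE mulrA -expr2 sqrr_sign mul1r.
  rewrite mxE /jet_form exchange_big; apply: eq_bigr => j _; rewrite !mxE mulr_suml.
  by apply: eq_bigr => k _; rewrite !mxE.
have Mz (a' b : 'I_l) : (l <= a' + b)%N -> M a' b = 0.
  by move=> h; rewrite mxE conc_mx_eq0.
have Ma (a' b : 'I_l) : (a' + b).+1 = l -> M a' b = (-1) ^+ a' * (pf_discr R l).[z].
  by move=> h; rewrite mxE conc_mx_anti// bop_lead_sum.
(* Entry [(0, l-1-b)] of [G *m M = 1]: column [l-1-b] of [M] vanishes below row [b], so row 0 of [G]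
   follows by forward substitution. *)
have K (b : 'I_l) : (forall a' : 'I_l, (a' < b)%N -> G (Ordinal l_gt0) a' = 0) ->
    G (Ordinal l_gt0) b * ((-1) ^+ b * (pf_discr R l).[z]) = (b == l.-1 :> nat)%:R.
  move=> IH; have bl := ltn_ord b; have cl : (l.-1 - b < l)%N by lia.
  have := congr1 (fun A : 'M[R]_l => A (Ordinal l_gt0) (Ordinal cl)) GM.
  rewrite /= mxE (bigD1 b)//= big1 ?addr0 => [|k kb].
    rewrite Ma => [->|/=]; last by lia.
    by rewrite mxE -val_eqE /=; congr (nat_of_bool _)%:R; apply/eqP/eqP; lia.
  case: (ltnP k b) => [kb'|bk]; first by rewrite IH// mul0r.
  by rewrite Mz ?mulr0//=; move: kb; rewrite -val_eqE /=; lia.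
have G0 n : (n < l.-1)%N -> forall (nl : (n < l)%N), G (Ordinal l_gt0) (Ordinal nl) = 0.
  elim/ltn_ind: n => n IH n1 nl; have := K (Ordinal nl).
  rewrite /= (ltn_eqF n1) => /(_ _)/eqP; rewrite mulf_eq0 mulf_eq0 signr_eq0 (negPf D0) !orbF.
  move=> H; apply/eqP/H => -[m ml] /= mn.
  by apply: IH => //; exact: ltn_trans n1.
rewrite (GE (Ordinal al)); case: eqP => [E|E]; last by rewrite G0 ?mulr0//; lia.
have : G (Ordinal l_gt0) (Ordinal al) * ((-1) ^+ a * (pf_discr R l).[z]) = 1.
  rewrite (K (Ordinal al)) => [|[m ml] /= mn]; last by apply: G0; lia.
  by rewrite /= (introT eqP E).
rewrite -E => H; apply: (mulIf D0); rewrite mulVf// -[RHS]H.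
by rewrite mulrCA mulrA.
Qed.

Lemma dPi_form k z : (k <= l)%N -> 0 < z < r ->
  z ^+ k *: ((dPi l varpi 0 z)^T *m SigmaM R l *m dPi l varpi k z) =
  (z ^+ 2 * \sum_(a < l.+1) (shifted_falling R k)`_a * jet_form a z)%:M.
Proof.
move=> kl zr; have z0 : z != 0 by rewrite gt_eqF//; case/andP: zr.
have [sv _] := hvarpi.
have E (j : 'I_l) : z ^+ k * derive1n k (varpi j) z =
    z * op_eval (theta_jet j) l.+1 (shifted_falling R k) z.
  have [_ H] := derive1n_theta (fun x xr => (sv j (ltn_ord j) x xr).1).
  exact: H.
rewrite [LHS]mx11_scalar; congr (_%:M); rewrite !mxE mulr_sumr.
transitivity (\sum_(j < l) \sum_(i < l) z ^+ 2 * (theta_jet i 0 z * SigmaM R l i j *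
    op_eval (theta_jet j) l.+1 (shifted_falling R k) z)).
  apply: eq_bigr => j _; rewrite !mxE mulrCA E !mulr_suml; apply: eq_bigr => i _.
  by rewrite !mxE /theta_jet /=; field.
rewrite exchange_big /= -[RHS](_ : \sum_(i < l) \sum_(j < l) \sum_(a < l.+1)
    z ^+ 2 * ((shifted_falling R k)`_a * (theta_jet i 0 z * SigmaM R l i j * theta_jet j a z)) = _).
  apply: eq_bigr => i _; apply: eq_bigr => j _; rewrite -mulr_sumr; congr (_ * _).
  by rewrite /op_eval mulr_sumr; apply: eq_bigr => a _; rewrite mulrCA mulrA [_ * (_ * _)]mulrCA mulrA.
under [LHS]eq_bigr => i _ do rewrite exchange_big.
rewrite exchange_big mulr_sumr; apply: eq_bigr => a _.
rewrite /jet_form !mulr_sumr; apply: eq_bigr => i _; rewrite !mulr_sumr.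
by [].
Qed.

Lemma dPi_formE k z : (k < l)%N -> 0 < z < r ->
  z ^+ k *: ((dPi l varpi 0 z)^T *m SigmaM R l *m dPi l varpi k z) =
  (if k == l.-1 then z ^+ 2 / (pf_discr R l).[z] else 0)%:M.
Proof.
move=> kl zr; rewrite dPi_form ?(ltnW kl)//; congr (_%:M).
have -> : \sum_(a < l.+1) (shifted_falling R k)`_a * jet_form a z =
    (shifted_falling R k)`_l.-1 / (pf_discr R l).[z].
  have l1 : (l.-1 < l.+1)%N by lia.
  rewrite (bigD1 (Ordinal l1))//= jet_formE ?eqxx//; last by lia.
  (* The index [a = l] lies outside the range of [jet_formE], but [shifted_falling k] has degree
     [k < l]. *)
  rewrite big1 ?addr0// => a ne; have := ltn_ord a; rewrite ltnS leq_eqVlt => /orP[/eqP ->|al].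
    by rewrite nth_default ?mul0r// size_shifted_falling.
  by rewrite jet_formE// ifN ?mulr0.
case: eqP => [->|kl1]; first by rewrite shifted_falling_lead mul1r.
by rewrite nth_default ?mul0r ?mulr0// size_shifted_falling; lia.
Qed.

End QuadraticRelations.

Theorem mainTheorem1 (R : realType) (l : nat) (hl : (1 <= l)%N)
    (B : nat -> {poly R}) (hB : banana_PF l B)
    (varpi : nat -> R -> R) (hvarpi : frobenius_basis l B varpi)
    (z : R) (hz : 0 < z < (l.+1%:R ^+ 2)^-1) :
  (forall k : nat, (k < l - 1)%N ->
     (dPi l varpi 0 z)^T *m SigmaM R l *m dPi l varpi k z = 0) /\
  (dPi l varpi 0 z)^T *m SigmaM R l *m dPi l varpi (l - 1) z = (Cl l z)%:M.
Proof.
have z0 : z != 0 by rewrite gt_eqF//; case/andP: hz.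
split=> [k kl|].
  have kl' : (k < l)%N by lia.
  have := dPi_formE hl hB hvarpi kl' hz; rewrite ifN; last by lia.
  move=> /eqP; rewrite raddf0 scaler_eq0 expf_eq0 (negPf z0) andbF /=.
  by move/eqP.
have ll : (l - 1 < l)%N by lia.
have := dPi_formE hl hB hvarpi ll hz; rewrite subn1 eqxx.
set A := (X in _ *: X = _) => E; apply: (scalerI (a := z ^+ l.-1)).
  by rewrite expf_eq0 (negPf z0) andbF.
rewrite E scale_scalar_mx; congr (_%:M).
have -> : (pf_discr R l).[z] = \prod_(m <- Delta l) (1 - m%:R * z).
  by rewrite horner_prod; apply: eq_bigr => m _; rewrite !hornerE.
(* The two factors [z] from [varpi = z (varpi / z)], against [z^(l-1)] from the derivative, produce
   the exponent [3 - l]. *)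
rewrite /Cl expfzDr// -exprnN -!exprnP invfM mulrA; congr (_ / _).
have -> : z ^+ l = z * z ^+ l.-1 by rewrite -exprS prednK.
rewrite invf_div.
have zl : z ^+ l.-1 != 0 by rewrite expf_eq0 (negPf z0) andbF.
field.
by rewrite z0 zl.
Qed.
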